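(* For every $c\in\mathbb{R}^+$, $p\in[1,\infty)$ and $q\in(1,\infty]$, the metric spaces $(\mathcal{X}_{p,q,c},d_M)$ and $(\mathcal{X}'_{p,q,c},d_M)$ are compact.
   Context: For a probability space $(\Omega,\mathcal{A},\mu)$, a $P$-operator on $\Omega$ is a linear map $A:L^\infty(\Omega)\to L^1(\Omega)$, written $v\mapsto vA$, with $\|A\|_{\infty\to1}<\infty$, where $\|A\|_{p\to q}:=\sup_{v\in L^\infty(\Omega)}\|vA\|_q/\|v\|_p$ for $p,q\in[1,\infty]$. For measurable $v_1,\dots,v_m$, $\mathcal{D}(v_1,\dots,v_m)$ is their joint distribution on $\mathbb{R}^m$. The $k$-profile $\mathcal{S}_k(A)$ is the set of measures $\mathcal{D}(v_1,\dots,v_k,v_1A,\dots,v_kA)$ on $\mathbb{R}^{2k}$ with $v_1,\dots,v_k$ measurable functions $\Omega\to[-1,1]$. $d_{\rm LP}$ is the Lévy–Prokhorov metric on Borel probability measures on $\mathbb{R}^m$, $d_H$ the associated Hausdorff distance between sets of such measures, and $d_M(A,B):=\sum_{k\ge1}2^{-k}d_H(\mathcal{S}_k(A),\mathcal{S}_k(B))$ for $P$-operators $A,B$ on possibly different spaces. Two $P$-operators are weakly equivalent if $d_M(A,B)=0$; $d_M$ is a metric on weak equivalence classes, and $\|\cdot\|_{p\to q}$ is constant on these classes. $\mathcal{X}_{p,q,c}$ denotes the set of weak equivalence classes of $P$-operators $A$ with $\|A\|_{p\to q}\le c$, and $\mathcal{X}'_{p,q,c}$ the set of those classes of $P$-operators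 defined on atomless probability spaces with $\|A\|_{p\to q}\le c$. *)

(* Defs.v *)
From HB Require Import structures.
From mathcomp Require Import all_boot all_order all_algebra.
From mathcomp Require Import all_classical all_reals all_analysis.

Set Implicit Arguments.
Unset Strict Implicit.
Unset Printing Implicit Defensive.

Import Order.TTheory GRing.Theory Num.Theory.
Import numFieldNormedType.Exports.
Local Open Scope classical_set_scope.
Local Open Scope ring_scope.

Section Defs.
Variable R : realType.

Definition Linf_fun d (T : measurableType d) (P : probability T R)
  (v : T -> R) : Prop :=
  measurable_fun setT v /\ exists M : R, {ae P, forall x, `|v x| <= M}.

Definition opnorm d (T : measurableType d) (P : probability T R)
  (A : (T -> R) -> (T -> R)) (p q : \bar R) : \bar R :=
  ereal_sup [set (Lnorm P q (EFin \o A v) *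
                   ((fine (Lnorm P p (EFin \o v)))^-1)%:E)%E
            | v in [set v | Linf_fun P v /\ Lnorm P p (EFin \o v) != 0%E]].

(* A P-operator on (T, P): a linear map L^infty -> L^1 with finite
   ||.||_{infty -> 1} norm.  Elements of L^infty / L^1 are represented by
   functions, the map being required to respect a.e. equality. *)
Record Poperator d (T : measurableType d) (P : probability T R) := {
  Pop :> (T -> R) -> (T -> R);
  Pop_meas : forall v, Linf_fun P v -> measurable_fun setT (Pop v);
  Pop_int : forall v, Linf_fun P v -> P.-integrable setT (EFin \o Pop v);
  Pop_ae : forall v w, Linf_fun P v -> Linf_fun P w ->
    {ae P, forall x, v x = w x} -> {ae P, forall x, Pop v x = Pop w x};
  Pop_lin : forall (a : R) v w, Linf_fun P v -> Linf_fun P w ->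
    {ae P, forall x, Pop (fun y => a * v y + w y) x = a * Pop v x + Pop w x};
  Pop_bdd : (opnorm P Pop +oo%E 1%:E < +oo)%E
}.

Definition atomless d (T : measurableType d) (P : probability T R) : Prop :=
  forall A, measurable A -> (0 < P A)%E ->
    exists B, [/\ measurable B, B `<=` A, (0 < P B)%E & (P B < P A)%E].

(* Measures on R^m = 'rV[R]_m (Euclidean metric), represented as set
   functions; only their values on Borel sets matter.                  *)
Definition eucl m (x y : 'rV[R]_m) : R :=
  Num.sqrt (\sum_(i < m) (x ord0 i - y ord0 i) ^+ 2).

Definition eopen m (U : set 'rV[R]_m) : Prop :=
  forall x, U x -> exists2 e : R, 0 < e & forall y, eucl x y < e -> U y.

Definition borel m : set (set 'rV[R]_m) := <<s [set U | @eopen m U] >>.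

Definition nbhd_set m (e : R) (B : set 'rV[R]_m) : set 'rV[R]_m :=
  [set x | exists2 y, B y & eucl x y < e].

Definition meas_Rm m := set 'rV[R]_m -> \bar R.

Definition dLP m (mu nu : meas_Rm m) : R :=
  inf [set e : R | 0 < e /\ forall B, borel B ->
        (mu B <= nu (nbhd_set e B) + e%:E)%E /\
        (nu B <= mu (nbhd_set e B) + e%:E)%E].

Definition dH m (S1 S2 : set (meas_Rm m)) : R :=
  Num.max (sup [set inf [set dLP mu nu | nu in S2] | mu in S1])
          (sup [set inf [set dLP mu nu | mu in S1] | nu in S2]).

Definition jdistr d (T : measurableType d) (P : probability T R) m
  (X : T -> 'rV[R]_m) : meas_Rm m := fun B => P (X @^-1` B).

Definition profile_vec d (T : measurableType d) k (A : (T -> R) -> (T -> R))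
  (v : 'I_k -> T -> R) (x : T) : 'rV[R]_(k + k) :=
  \row_(i < k + k) match fintype.split i with
                   | inl j => v j x
                   | inr j => A (v j) x
                   end.

Definition profile d (T : measurableType d) (P : probability T R)
  (A : (T -> R) -> (T -> R)) (k : nat) : set (meas_Rm (k + k)) :=
  [set jdistr P (profile_vec A v) | v in
     [set v : 'I_k -> T -> R | forall i, measurable_fun setT (v i) /\
                                 forall x, -1 <= v i x <= 1]].

Arguments profile {d T} P A k _.

Definition dM d (T : measurableType d) (P : probability T R)
  d' (T' : measurableType d') (P' : probability T' R)
  (A : (T -> R) -> (T -> R)) (B : (T' -> R) -> (T' -> R)) : R :=
  limn (fun n => \sum_(1 <= k < n) (2 ^- k * dH (profile P A k) (profile P' B k))).

End Defs.

(* Main.v *)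
(* Fix a nonprincipal ultrafilter U on nat.  The Loeb space of the sequence
   (T n, P n) is the product of the T n, with the measure extending
   E |-> lim_U P n (E n) from the internal sets {w | E n (w n) for U-many n};
   saturation makes this measure countably additive on the sets that agree with
   an internal set up to a null set.  Every bounded measurable v on the Loeb
   space is a.e. the ultralimit of bounded functions v n, and A v is defined as
   the ultralimit of A n (v n).  This is well defined because ||.||_{p->q} is
   uniformly bounded and p < oo: if v n tends to 0 a.e. along U, then
   ||v n||_p tends to 0, hence so does ||A n (v n)||_q.  Fatou's lemma for
   ultralimits gives ||A||_{p->q} <= c.  Random vectors converging a.e. along U
   converge in the Levy-Prokhorov distance, so the profiles of A n converge
   along U to those of A, and a subsequence converges. *)

Require Import Defs.
From HB Require Import structures.
From mathcomp Require Import all_boot all_order all_algebra.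
From mathcomp Require Import all_classical all_reals all_analysis.
From mathcomp Require Import measurable_realfun ess_sup_inf ring lra.

Set Implicit Arguments.
Unset Strict Implicit.
Unset Printing Implicit Defensive.

Import Order.TTheory GRing.Theory Num.Theory.
Import numFieldNormedType.Exports.
Local Open Scope classical_set_scope.
Local Open Scope ring_scope.

(** * Ultralimits and the measure of internal sets *)

(** The difficulty is uniformity. For one sequence [v n], or for one [v] on the limit space,
    closeness of the joint distributions comes from pointwise convergence along [U]; the Hausdorff
    distance asks that a single [n] serve all [v] at once. Both inclusions therefore argue by
    contradiction: a worst function is chosen for each [n], and the sequence of these choices is
    itself passed to an ultraproduct. In the inclusion of the limit profile the worst functions live
    on the Loeb space and still vary with [n], so lifting one of them is not enough. The ultrafilter
    decides all limits simultaneously, so the limit operator is defined on all of L^infty without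
    separability of the [T n] and without tightness of the profiles; a subsequence is extracted only
    at the end, from the real numbers [dM]. The functions [A n (v n)] need not be uniformly bounded,
    and the ultralimit of an unbounded sequence is a meaningless default. Markov's inequality
    confines this to a null set, which is why boundedness along [U] accompanies every statement
    about ultralimits of images. *)

Lemma dep_choice (I : Type) (T : I -> Type) (Q : forall i, T i -> Prop) :
  (forall i, exists x, Q i x) -> exists f : forall i, T i, forall i, Q i (f i).
Proof. by move=> QP; exists (fun i => projT1 (cid (QP i))) => i;
  exact: projT2. Qed.

Section MeasurableRays.
Context d (T : measurableType d) (R : realType) (f : T -> R) (a : R).
Hypothesis mf : measurable_fun setT f.

Lemma measurable_gt : measurable [set x | a < f x].
Proof.
have := mf measurableT (measurable_itv `]a, +oo[); rewrite setTI.
by congr measurable; apply/seteqP; split=> x /=; rewrite in_itv/= andbT.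
Qed.

Lemma measurable_ge : measurable [set x | a <= f x].
Proof.
have := mf measurableT (measurable_itv `[a, +oo[); rewrite setTI.
by congr measurable; apply/seteqP; split=> x /=; rewrite in_itv/= andbT.
Qed.

Lemma measurable_lt : measurable [set x | f x < a].
Proof.
have := mf measurableT (measurable_itv `]-oo, a[); rewrite setTI.
by congr measurable; apply/seteqP; split=> x /=; rewrite in_itv/=.
Qed.

End MeasurableRays.

Section UltraLimit.
Context (R : realType) (U : set_system nat) (UF : UltraFilter U).
Implicit Types u v : nat -> R.

Lemma ultraC (A : set nat) : ~ U A -> U (~` A).
Proof. by have [] := in_ultra_setVsetC A UF. Qed.

Lemma ultraNC (A : set nat) : U A -> ~ U (~` A).
Proof.
by move=> UA UCA; have /filter_ex[n []] : U (A `&` ~` A) by exact: filterI.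
Qed.

(** [lim] takes a default value where [u] does not converge along [U]; the rules for sums, products
    and order are therefore stated under [ubounded]. *)
Definition ulim u : R := lim (u @ U).

Definition ubounded u := exists M : R, \forall n \near U, `|u n| <= M.

Lemma ulim_eq u l : u @ U --> l -> ulim u = l.
Proof. by move=> ul; apply: cvg_lim ul => //; exact: Rhausdorff. Qed.

(** Compactness of [[-M, M]] yields a cluster point, and a cluster point of an ultrafilter is a
    limit. *)
Lemma cvg_ulim u : ubounded u -> u @ U --> ulim u.
Proof.
move=> [M uM].
have [|l [_ ul]] := @segment_compact R (- M) M (u @ U) _.
  by apply: filterS uM => n; rewrite /= in_itv/= -ler_norml.
have {}ul : u @ U --> l.
  move=> V lV; apply: contrapT => /ultraC UV.
  by have [x []] := ul (~` V) V UV lV.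
by rewrite (ulim_eq ul).
Qed.

Lemma ubounded_bnd u (M : R) : (forall n, `|u n| <= M) -> ubounded u.
Proof. by move=> uM; exists M; near=> n. Unshelve. all: by end_near. Qed.

Lemma uboundedD u v : ubounded u -> ubounded v -> ubounded (fun n => u n + v n).
Proof.
move=> [M uM] [N vN]; exists (M + N); near=> n.
by rewrite (le_trans (ler_normD _ _))// lerD//; near: n.
Unshelve. all: by end_near. Qed.

Lemma uboundedM u v : ubounded u -> ubounded v -> ubounded (fun n => u n * v n).
Proof.
move=> [M uM] [N vN]; exists (M * N); near=> n.
by rewrite normrM ler_pM//; near: n.
Unshelve. all: by end_near. Qed.

Lemma ulimD u v : ubounded u -> ubounded v ->
  ulim (fun n => u n + v n) = ulim u + ulim v.
Proof. by move=> /cvg_ulim ? /cvg_ulim ?; apply: ulim_eq; exact: cvgD. Qed.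

Lemma ulimM u v : ubounded u -> ubounded v ->
  ulim (fun n => u n * v n) = ulim u * ulim v.
Proof. by move=> /cvg_ulim ? /cvg_ulim ?; apply: ulim_eq; exact: cvgM. Qed.

Lemma ulim_cst (a : R) : ulim (fun=> a) = a.
Proof. by apply: ulim_eq; exact: cvg_cst. Qed.

Lemma ulim_le u v : ubounded u -> ubounded v ->
  (\forall n \near U, u n <= v n) -> ulim u <= ulim v.
Proof.
move=> bu bv uv.
exact: ler_cvg_to (cvg_ulim bu) (cvg_ulim bv) uv.
Qed.

Lemma ulim_le_cst u (a : R) : ubounded u ->
  (\forall n \near U, u n <= a) -> ulim u <= a.
Proof.
move=> bu ua; rewrite -(ulim_cst a); apply: ulim_le => //.
exact: (@ubounded_bnd _ `|a|).
Qed.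

Lemma ulim_ge_cst u (a : R) : ubounded u ->
  (\forall n \near U, a <= u n) -> a <= ulim u.
Proof.
move=> bu ua; rewrite -[leLHS](ulim_cst a); apply: ulim_le => //.
exact: (@ubounded_bnd _ `|a|).
Qed.

Lemma ulim_lt u (a : R) : ubounded u -> ulim u < a ->
  \forall n \near U, u n < a.
Proof.
move=> bu ua; apply: (cvgr_lt _ (cvg_ulim bu)) ua.
Qed.

Lemma ulim_gt u (a : R) : ubounded u -> a < ulim u ->
  \forall n \near U, a < u n.
Proof.
move=> bu ua; apply: (cvgr_gt _ (cvg_ulim bu)) ua.
Qed.

End UltraLimit.

Section LoebMeasure.
Context (R : realType) (U : set_system nat) (UF : UltraFilter U)
  (Uoo : \oo `<=` U)
  (d : nat -> measure_display) (T : forall n, measurableType (d n))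
  (P : forall n, probability (T n) R).

Definition iset := forall n, set (T n).
Implicit Types E F G : iset.

Definition imeas E := forall n, measurable (E n).

Definition internal E : set (forall n, T n) :=
  [set w | \forall n \near U, E n (w n)].

Definition imu E : R := ulim U (fun n => fine (P n (E n))).

Definition isetC E : iset := fun n => ~` E n.
Definition isetU E F : iset := fun n => E n `|` F n.
Definition isetD E F : iset := fun n => E n `\` F n.
Definition iset0 : iset := fun n => set0.

Lemma imeasC E : imeas E -> imeas (isetC E).
Proof. by move=> mE n; exact: measurableC. Qed.

Lemma imeasU E F : imeas E -> imeas F -> imeas (isetU E F).
Proof. by move=> mE mF n; exact: measurableU. Qed.

Lemma imeasD E F : imeas E -> imeas F -> imeas (isetD E F).
Proof. by move=> mE mF n; exact: measurableD. Qed.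

Lemma imeas0 : imeas iset0. Proof. by move=> n; exact: measurable0. Qed.

Lemma internalC E : internal (isetC E) = ~` internal E.
Proof.
apply/seteqP; split=> w; first by move=> ? ?;
  exact: (@ultraNC U UF [set n | E n (w n)]).
by move=> /ultraC; apply.
Qed.

Lemma internalU E F : internal (isetU E F) = internal E `|` internal F.
Proof.
apply/seteqP; split=> w /=.
  move=> EF; apply: contrapT => /not_orP[/ultraC E' /ultraC F'].
  have /filter_ex[n [] [En|Fn] []//] : U ([set n | (E n `|` F n) (w n)] `&`
    (~` [set n | E n (w n)] `&` ~` [set n | F n (w n)])).
  by apply: filterI => //; apply: filterI; [exact: E'|exact: F'].
by move=> [] /filterS; apply => n ?; [left|right].
Qed.

Lemma internalD E F : internal (isetD E F) = internal E `\` internal F.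
Proof.
apply/seteqP; split=> w /=.
  move=> EF; split; first by apply: filterS EF => n [].
  suff : (~` internal F) w by [].
  by rewrite -internalC; apply: filterS EF => n [].
move=> [EE /ultraC EF]; near=> n; split; first by near: n.
by near: n; exact: EF.
Unshelve. all: by end_near. Qed.

(** If the inclusion failed for [U]-many [n], a choice of points of [E n] outside [F n] at these
    [n], with arbitrary coordinates elsewhere, would be a point of the first internal set that
    misses the second. *)
Lemma internal_subP E F : internal E `<=` internal F ->
  \forall n \near U, E n `<=` F n.
Proof.
move=> EF; apply: contrapT => /ultraC nEF.
have [w wP] : exists w : forall n, T n, forall n, ~ E n `<=` F n ->
  (E n `\` F n) (w n).
  apply: (dep_choice (Q := fun n t => ~ E n `<=` F n -> (E n `\` F n) t)) => n.
  have [|/existsNP[t /not_implyP[]]] := pselect (E n `<=` F n).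
    by exists point.
  by exists t.
have Ew : internal E w by apply: filterS nEF => n /wP[].
have Fw := EF _ Ew.
have /filter_ex[n [Fn []]] : U ([set n | F n (w n)] `&` ~` [set n | F n (w n)]).
  by apply: filterI => //; apply: filterS nEF => n /wP[].
by [].
Qed.

Lemma internal_monoP E F : (\forall n \near U, E n `<=` F n) ->
  internal E `<=` internal F.
Proof.
move=> EF w Ew; near=> n.
suff : E n (w n) by apply: (near EF n) => //; near: n.
by near: n.
Unshelve. all: by end_near. Qed.

Lemma fine_prob_le1 n (A : set (T n)) : measurable A -> `|fine (P n A)| <= 1.
Proof.
move=> mA; rewrite ger0_norm ?fine_ge0//.
by rewrite -lee_fin fineK ?probability_le1// fin_num_measure.
Qed.

Lemma ubounded_prob E : imeas E -> ubounded U (fun n => fine (P n (E n))).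
Proof. by move=> mE; apply: (@ubounded_bnd _ _ _ _ 1) => n;
  exact: fine_prob_le1. Qed.

Lemma imu_le E F : imeas E -> imeas F -> internal E `<=` internal F ->
  imu E <= imu F.
Proof.
move=> mE mF /internal_subP EF; apply: ulim_le; [exact: ubounded_prob..|].
apply: filterS EF => n EF; rewrite fine_le ?fin_num_measure//.
by rewrite le_measure// inE.
Qed.

Lemma imu_eq E F : imeas E -> imeas F -> internal E = internal F ->
  imu E = imu F.
Proof. by move=> mE mF EF; apply/eqP; rewrite eq_le !imu_le// EF. Qed.

Lemma imu_ge0 E : imeas E -> 0 <= imu E.
Proof.
move=> mE; apply: ulim_ge_cst; first exact: ubounded_prob.
by near=> n; rewrite fine_ge0.
Unshelve. all: by end_near. Qed.

Lemma imu_le1 E : imeas E -> imu E <= 1.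
Proof.
move=> mE; apply: ulim_le_cst; first exact: ubounded_prob.
near=> n; apply: le_trans (fine_prob_le1 (mE n)); exact: ler_norm.
Unshelve. all: by end_near. Qed.

Lemma imu_setU E F : imeas E -> imeas F -> internal E `&` internal F = set0 ->
  imu (isetU E F) = imu E + imu F.
Proof.
move=> mE mF EF; rewrite /imu -ulimD; [|exact: ubounded_prob..].
have /internal_subP EF0 : internal E `<=` internal (isetC F).
  by rewrite internalC; apply/disjoints_subset.
apply/eqP; rewrite eq_le; apply/andP; split; apply: ulim_le;
  do ?[exact: ubounded_prob|exact: (ubounded_prob (imeasU _ _))
      |apply: uboundedD; exact: ubounded_prob];
  apply: filterS EF0 => n EF0; rewrite measureU//= ?fineD ?fin_num_measure//;
  exact/disjoints_subset.
Qed.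

Lemma imuC E : imeas E -> imu (isetC E) = 1 - imu E.
Proof.
move=> mE; apply/eqP; rewrite eq_sym subr_eq addrC -imu_setU//; last 2 first.
- exact: imeasC.
- by rewrite internalC setICr.
rewrite /imu (_ : (fun n => _) = cst 1) ?ulim_cst//.
by apply/funext => n; rewrite /isetU /isetC setUv probability_setT.
Qed.

Lemma imu0 : imu iset0 = 0.
Proof. by rewrite /imu /iset0; under eq_fun do rewrite measure0;
  exact: ulim_cst. Qed.

Lemma imuD E F : imeas E -> imeas F -> internal F `<=` internal E ->
  imu (isetD E F) = imu E - imu F.
Proof.
move=> mE mF FE; apply/eqP; rewrite eq_sym subr_eq -imu_setU//; last 2 first.
- exact: imeasD.
- by rewrite internalD setDE -setIA setICl setI0.
apply/eqP/imu_eq => //; first by apply: imeasU => //; exact: imeasD.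
by rewrite internalU internalD setUC setDUK.
Qed.

Lemma imuU_le E F : imeas E -> imeas F -> imu (isetU E F) <= imu E + imu F.
Proof.
move=> mE mF.
have -> : imu (isetU E F) = imu (isetU E (isetD F E)).
  apply: imu_eq; [exact: imeasU|by apply: imeasU => //; exact: imeasD|].
  by rewrite !internalU internalD setUDr setDv setD0.
rewrite imu_setU//; last 2 first.
- exact: imeasD.
- by rewrite internalD setDE setIC -setIA setICl setI0.
by rewrite lerD2l imu_le//; [exact: imeasD|rewrite internalD; exact: subDsetl].
Qed.

(* Aleph_1-saturation: in coordinate n take the last F k, k <= n, whose measure
   is at most s + 1/(k+1); this index tends to infinity along U. *)
Lemma saturation (F : nat -> iset) (s : R) :
  (forall k, imeas (F k)) -> (forall k n, F k n `<=` F k.+1 n) ->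
  (forall k, imu (F k) <= s) ->
  exists E, [/\ imeas E, forall k, internal (F k) `<=` internal E & imu E <= s].
Proof.
move=> mF Fs lF.
have Fmono n k l : (k <= l)%N -> F k n `<=` F l n.
  move=> kl; rewrite -(subnK kl); elim: (l - k)%N => [//|i IH].
  by apply: subset_trans IH _; rewrite addSn; exact: Fs.
pose good n k := (k <= n)%N && (fine (P n (F k n)) <= s + k.+1%:R^-1).
have goodU k : \forall n \near U, good n k.
  have : \forall n \near U, fine (P n (F k n)) < s + k.+1%:R^-1.
    apply: ulim_lt; first exact: ubounded_prob.
    by rewrite (le_lt_trans (lF k))// ltrDl invr_gt0.
  have : \forall n \near U, (k <= n)%N by apply: Uoo; exists k.
  by apply: filterS2 => n kn ?; rewrite /good kn ltW.
have /choice[K KP] n : exists K, forall k, good n k -> (k <= K)%N /\ good n K.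
  have [[k0 g0]|/forallNP ng] := pselect (exists k, good n k); last first.
    by exists 0%N => k /ng.
  have bnd i : good n i -> (i <= n)%N by move=> /andP[].
  case: (ex_maxnP (ex_intro _ k0 g0) bnd) => i gi imax.
  by exists i => k gk; split => //; exact: imax.
exists (fun n => F (K n) n); split => [n|k|]; first exact: mF.
  by apply: internal_monoP; apply: filterS (goodU k) => n /KP[/Fmono].
have bE : ubounded U (fun n => fine (P n (F (K n) n))).
  by apply: ubounded_prob => n; exact: mF.
apply/ler_addgt0Pr => e e0.
have [k ke] : exists k, k.+1%:R^-1 < e.
  by exists (Num.truncn e^-1); rewrite invf_plt ?posrE// truncnS_gt.
apply: ulim_le_cst => //; apply: filterS (goodU k) => n /KP[kK /andP[_ gK]].
apply: (le_trans gK); rewrite lerD2l; apply: le_trans (ltW ke).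
by rewrite lef_pV2 ?posrE// ler_nat.
Qed.

(** Covers by a single internal set are enough here: saturation replaces a countable cover by one
    internal set without increasing the bound on the measure. *)
Definition loeb_null (X : set (forall n, T n)) :=
  forall e : R, 0 < e -> exists F, [/\ imeas F, X `<=` internal F & imu F <= e].

Lemma loeb_null_sub X Y : X `<=` Y -> loeb_null Y -> loeb_null X.
Proof. by move=> XY nY e /nY[F [mF YF Fe]]; exists F; split => //;
  exact: subset_trans YF. Qed.

Fixpoint icumul (F : nat -> iset) k : iset :=
  if k is j.+1 then isetU (icumul F j) (F j) else iset0.

Lemma imeas_icumul (F : nat -> iset) k :
  (forall k, imeas (F k)) -> imeas (icumul F k).
Proof. by move=> mF; elim: k => [|k IH]; [exact: imeas0|exact: imeasU]. Qed.

(** The [k]-th set is covered within [e / 2 ^+ k.+1], so all finite unions of the covers have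
    measure at most [e]; saturation encloses them in one internal set with the same bound. *)
Lemma loeb_null_bigcup (X : nat -> set (forall n, T n)) :
  (forall k, loeb_null (X k)) -> loeb_null (\bigcup_k X k).
Proof.
move=> nX e e0.
have /choice[F FP] k : exists F, [/\ imeas F,
  X k `<=` internal F & imu F <= e / 2 ^+ k.+1].
  by apply: nX; rewrite divr_gt0.
pose H := icumul F.
have mH k : imeas (H k) by apply: imeas_icumul => {}k; have [] := FP k.
have HE k : imu (H k) <= e * (1 - (2 ^+ k)^-1).
  elim: k => [|k IH]; first by rewrite imu0 expr0 invr1 subrr mulr0.
  rewrite /= (le_trans (imuU_le _ _))//; first by have [] := FP k.
  rewrite (le_trans (lerD IH (let: And3 _ _ h := FP k in h)))//.
  rewrite exprS -mulrDr ler_pM2l// invfM.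
  by set x := (2 ^+ k)^-1; lra.
have [| |E [mE HE' lE]] := @saturation H e mH.
- by move=> k n; left.
- by move=> k; apply: (le_trans (HE k)); rewrite -[leRHS]mulr1 ler_pM2l.
exists E; split => // w [k _ Xw]; apply: (HE' k.+1) => /=.
by rewrite internalU; right; have [_ + _] := FP k; apply.
Qed.

Lemma loeb_null0 : loeb_null set0.
Proof. by move=> e e0; exists iset0; split;
  [exact: imeas0|exact: sub0set|rewrite imu0 ltW]. Qed.

Lemma loeb_nullU X Y : loeb_null X -> loeb_null Y -> loeb_null (X `|` Y).
Proof.
move=> nX nY; rewrite -bigcup2E; apply: loeb_null_bigcup => -[//|[//|k]] /=.
exact: loeb_null0.
Qed.

Lemma loeb_null_imu E : imeas E -> loeb_null (internal E) -> imu E = 0.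
Proof.
move=> mE nE; apply/eqP; rewrite eq_le imu_ge0// andbT.
apply/ler_addgt0Pr => e e0; rewrite add0r.
have [F [mF EF Fe]] := nE e e0.
by apply: le_trans Fe; exact: imu_le.
Qed.

Lemma imu_loeb_null E : imeas E -> imu E = 0 -> loeb_null (internal E).
Proof. by move=> mE E0 e e0; exists E; split; rewrite // E0 ltW. Qed.

Definition loeb_rep (X : set (forall n, T n)) E :=
  imeas E /\ loeb_null [set w | ~ (X w <-> internal E w)].

Definition loeb_meas X := exists E, loeb_rep X E.

(** The internal set of [E] minus [F] lies in the union of three null sets, and a null internal set
    has [imu] equal to 0. For [X = Y] this makes the measure independent of the representative. *)
Lemma loeb_rep_le X Y E F : loeb_rep X E -> loeb_rep Y F ->
  loeb_null (X `\` Y) -> imu E <= imu F.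
Proof.
move=> [mE nE] [mF nF] nXY.
rewrite -subr_ge0.
have mD : imeas (isetD E F) by exact: imeasD.
have D0 : imu (isetD E F) = 0.
  apply: loeb_null_imu => //.
  apply: loeb_null_sub (loeb_nullU nXY (loeb_nullU nE nF)) => w;
    rewrite internalD => -[Ew Fw].
  have [Xw|Xw] := pselect (X w); last by right; left => -[_ /(_ Ew)].
  have [Yw|Yw] := pselect (Y w); last by left.
  by right; right => -[/(_ Yw)].
rewrite subr_ge0 -[leRHS]add0r -D0.
apply: le_trans (imuU_le mD mF); apply: imu_le => //; first exact: imeasU.
by rewrite internalU internalD => w Ew; have [?|?] := pselect (internal F w);
  [right|left].
Qed.

Lemma loeb_rep_eq X E F : loeb_rep X E -> loeb_rep X F -> imu E = imu F.
Proof.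
move=> rE rF; apply/eqP; rewrite eq_le (loeb_rep_le rE rF) ?(loeb_rep_le rF
  rE)//;
  by rewrite setDv; exact: loeb_null0.
Qed.

Lemma loeb_rep_internal E : imeas E -> loeb_rep (internal E) E.
Proof. by move=> mE; split => //; apply: loeb_null_sub loeb_null0 => w /=;
  apply. Qed.

Lemma loeb_repC X E : loeb_rep X E -> loeb_rep (~` X) (isetC E).
Proof.
move=> [mE nE]; split; first exact: imeasC.
apply: loeb_null_sub nE => w /=; rewrite internalC/= => XE EX; apply: XE.
by split => h h'; apply: h; apply/EX.
Qed.

Lemma loeb_repU X Y E F : loeb_rep X E -> loeb_rep Y F ->
  loeb_rep (X `|` Y) (isetU E F).
Proof.
move=> [mE nE] [mF nF]; split; first exact: imeasU.
apply: loeb_null_sub (loeb_nullU nE nF) => w /=; rewrite internalU.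
move=> XYEF; apply: contrapT => /not_orP[/contrapT XE /contrapT YF].
by apply: XYEF; split => -[/XE|/YF]; by [left|right].
Qed.

Lemma loeb_rep0 : loeb_rep set0 iset0.
Proof.
split; first exact: imeas0; apply: loeb_null_sub loeb_null0 => w /=.
by apply; split => // /filter_ex[].
Qed.

Lemma loeb_rep_null X Y E : loeb_null [set w | ~ (X w <-> Y w)] ->
  loeb_rep X E -> loeb_rep Y E.
Proof.
move=> nXY [mE nE]; split => //; apply: loeb_null_sub (loeb_nullU nXY nE) =>
  w /= YE.
apply: contrapT => /not_orP[/contrapT XY /contrapT XE]; apply: YE.
by rewrite -XY.
Qed.

(* An increasing union of internal sets is internal up to a null set, and its
   measure is the limit of the measures. *)
Lemma loeb_rep_increasing (F : nat -> iset) : (forall k, imeas (F k)) ->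
    (forall k n, F k n `<=` F k.+1 n) ->
  exists E, loeb_rep (\bigcup_k internal (F k)) E /\ (imu \o F) @ \oo --> imu E.
Proof.
move=> mF Fs; pose s := sup (range (imu \o F)).
have Fnd : nondecreasing_seq (imu \o F).
  apply/nondecreasing_seqP => k; apply: imu_le => //.
  by apply: internal_monoP; near=> n; exact: Fs.
have Fub : has_ubound (range (imu \o F)) by exists 1 => _ [k _ <-];
  exact: imu_le1.
have Fcvg : (imu \o F) @ \oo --> s by exact: nondecreasing_cvgn.
have lF k : imu (F k) <= s by apply: ub_le_sup => //; exists k.
have [E [mE FE Es]] := saturation mF Fs lF.
have lE : imu E = s.
  apply/eqP; rewrite eq_le Es/=; apply: ge_sup;
    first by exists (imu (F 0)), 0%N.
  by move=> _ [k _ <-]; exact: imu_le.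
exists E; split; last by rewrite lE.
split=> // e e0; have [k ke] : exists k, s - imu (F k) < e.
  have [k _ ke] := (cvgrPdist_lt _ _).1 Fcvg e e0.
  by exists k; rewrite (le_lt_trans _ (ke k _))//= ler_norm.
(* What [E] has beyond the union lies outside every [F k], so it is covered by sets of measure
   [s - imu (F k)], which tends to 0. *)
exists (isetD E (F k)); split; first exact: imeasD.
  rewrite internalD => w /= EF; have [Ew|Ew] := pselect (internal E w);
    last first.
    by exfalso; apply: EF; split=> // -[j _ /FE].
  split=> // Fw; apply: EF; split=> // _.
  by exists k.
by rewrite imuD// lE ltW.
Unshelve. all: by end_near. Qed.

Lemma loeb_rep_bigcup (X : nat -> set (forall n, T n)) (F : nat -> iset) :
  (forall k, loeb_rep (X k) (F k)) ->
  exists E, loeb_rep (\bigcup_k X k) E /\ (imu \o icumul F) @ \oo --> imu E.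
Proof.
move=> FP; have mF k : imeas (F k) by have [] := FP k.
have mH k := imeas_icumul k mF.
have HP k : loeb_rep (\bigcup_(i in `I_k) X i) (icumul F k).
  elim: k => [|k IH]; first by rewrite II0 bigcup_set0; exact: loeb_rep0.
  by rewrite IIS bigcup_setU bigcup_set1; exact: loeb_repU.
have [|E [[mE nE] HE]] := loeb_rep_increasing mH; first by move=> k n; left.
exists E; split=> //; split=> //.
have nH : loeb_null (\bigcup_k
    [set w | ~ ((\bigcup_(i in `I_k) X i) w <-> internal (icumul F k) w)]).
  by apply: loeb_null_bigcup => k; have [] := HP k.
apply: loeb_null_sub (loeb_nullU nE nH) => w /= XE.
apply: contrapT => /not_orP[/contrapT {}HE XH]; apply: XE; rewrite -HE.
have {}XH k : (\bigcup_(i in `I_k) X i) w <-> internal (icumul F k) w.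
  by apply: contrapT => nk; apply: XH; exists k.
split; first by move=> [k _ Xw]; exists k.+1 => //; apply/XH; exists k => /=.
by move=> [k _ /XH[i _ Xw]]; exists i.
Qed.

Lemma loeb_meas_bigcup (X : nat -> set (forall n, T n)) :
  (forall k, loeb_meas (X k)) -> loeb_meas (\bigcup_k X k).
Proof.
by move=> /choice[F /loeb_rep_bigcup[E [XE _]]]; exists E.
Qed.

Lemma loeb_repD X Y E F : loeb_rep X E -> loeb_rep Y F ->
  loeb_rep (X `\` Y) (isetD E F).
Proof.
move=> [mE nE] [mF nF]; split; first exact: imeasD.
apply: loeb_null_sub (loeb_nullU nE nF) => w /=; rewrite internalD.
move=> XYEF; apply: contrapT => /not_orP[/contrapT XE /contrapT YF].
by apply: XYEF; split=> -[/XE ? nY]; split=> // /YF.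
Qed.

Lemma loeb_null_rep X : loeb_null X -> loeb_rep X iset0.
Proof. by move=> nX; apply: loeb_rep_null loeb_rep0;
  apply: loeb_null_sub nX => w /= X0; apply: contrapT => nXw; apply: X0;
  split. Qed.

Lemma loeb_rep0_null X E : loeb_rep X E -> imu E = 0 -> loeb_null X.
Proof.
move=> [mE nE] E0; apply: loeb_null_sub (loeb_nullU (imu_loeb_null mE E0) nE)
  => w Xw.
by have [|nEw] := pselect (internal E w); [left|right => -[/(_ Xw)]].
Qed.

Definition loeb_mu (X : set (forall n, T n)) : R :=
  imu (xget iset0 [set E | loeb_rep X E]).

Lemma loeb_muE X E : loeb_rep X E -> loeb_mu X = imu E.
Proof.
by move=> XE; rewrite /loeb_mu; case: xgetP => [F _ FX|/(_ E)/(_ XE)//];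
  exact: loeb_rep_eq FX XE.
Qed.

(** Disjointness allows [X n] to be represented by [F n] minus the earlier [F i], so the partial
    sums are exactly the measures of the increasing internal sets [icumul F n], whose limit is
    already known. *)
Lemma loeb_mu_sigma_additive (X : nat -> set (forall n, T n)) :
  (forall k, loeb_meas (X k)) -> trivIset setT X ->
  (fun n => \sum_(0 <= i < n) loeb_mu (X i)) @ \oo --> loeb_mu (\bigcup_k X k).
Proof.
move=> /choice[F FX] tX.
have [E [XE HE]] := loeb_rep_bigcup FX.
have mF k : imeas (F k) by have [] := FX k.
rewrite (loeb_muE XE) (_ : (fun n => _) = imu \o icumul F)//; apply/funext.
elim=> [|n IH]; first by rewrite big_nil/= imu0.
rewrite big_nat_recr//= IH/=; symmetry.
have mH := imeas_icumul n mF.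
have HP : loeb_rep (\bigcup_(i in `I_n) X i) (icumul F n).
  elim: (n) => [|k IHk]; first by rewrite II0 bigcup_set0; exact: loeb_rep0.
  by rewrite IIS bigcup_setU bigcup_set1; exact: loeb_repU.
have /loeb_muE -> : loeb_rep (X n) (isetD (F n) (icumul F n)).
  rewrite (_ : X n = X n `\` \bigcup_(i in `I_n) X i); first exact: loeb_repD.
  rewrite setDidl// predeqE => w; split => // -[Xnw [i /= ilt Xiw]].
  have in_ : i = n by apply: tX => //; exists w.
  by rewrite in_ ltnn in ilt.
rewrite -imu_setU//; last 2 first.
- exact: imeasD.
- by rewrite internalD setDE setIC -setIA setICl setI0.
apply: imu_eq; [exact: imeasU|by apply: imeasU => //; exact: imeasD|].
by rewrite !internalU internalD setUDr setDv setD0.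
Qed.

End LoebMeasure.

(** * The Loeb space *)

Section LoebSpace.
Context (R : realType) (U : set_system nat) (UF : UltraFilter U)
  (Uoo : \oo `<=` U)
  (d : nat -> measure_display) (T : forall n, measurableType (d n))
  (P : forall n, probability (T n) R).

(* The unused arguments key the sigma-algebra and the measure on the product. *)
Definition loeb of UltraFilter U & \oo `<=` U &
  (forall n, probability (T n) R) := forall n, T n.

Local Notation L := (loeb UF Uoo P).

HB.instance Definition _ := Pointed.copy L (forall n, T n).

Lemma loeb_meas0 : loeb_meas U P set0.
Proof. by exists (@iset0 d T); exact: loeb_rep0. Qed.

Lemma loeb_measC X : loeb_meas U P X -> loeb_meas U P (~` X).
Proof. by move=> [E XE]; exists (isetC E); exact: loeb_repC. Qed.

HB.instance Definition _ := @isMeasurable.Build default_measure_display L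
  (loeb_meas U P) loeb_meas0 loeb_measC (@loeb_meas_bigcup _ _ UF Uoo _ _ P).

Definition loeb_prob (X : set L) : \bar R := (loeb_mu U P X)%:E.

Lemma loeb_prob0 : loeb_prob set0 = 0%E.
Proof. by rewrite /loeb_prob (loeb_muE UF Uoo (loeb_rep0 UF P)) imu0. Qed.

Lemma loeb_prob_ge0 X : (0 <= loeb_prob X)%E.
Proof.
rewrite lee_fin /loeb_mu; case: xgetP => [E _ [mE _]|_]; first exact: imu_ge0.
by rewrite imu0.
Qed.

Lemma loeb_prob_sigma_additive : semi_sigma_additive loeb_prob.
Proof.
move=> F mF tF mUF; under eq_fun do rewrite sumEFin.
by apply: cvg_EFin; [near=> n|exact: loeb_mu_sigma_additive].
Unshelve. all: by end_near. Qed.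

HB.instance Definition _ := isMeasure.Build _ _ _ loeb_prob
  loeb_prob0 loeb_prob_ge0 loeb_prob_sigma_additive.

Lemma loeb_probT : loeb_prob [set: L] = 1%:E.
Proof.
rewrite -setC0 /loeb_prob (loeb_muE UF Uoo (loeb_repC UF (loeb_rep0 UF P)))
  imuC ?imu0 ?subr0//.
exact: imeas0.
Qed.

HB.instance Definition _ := Measure_isProbability.Build _ _ _ loeb_prob
  loeb_probT.

Lemma loeb_probE (X : set L) E : loeb_rep U P X E ->
  loeb_prob X = (imu U P E)%:E.
Proof. by move=> XE; rewrite /loeb_prob (loeb_muE UF Uoo XE). Qed.

Lemma measurable_loeb_rep (X : set L) : measurable X -> exists E, loeb_rep U P X E.
Proof. by []. Qed.

Lemma loeb_rep_measurable (X : set L) E : loeb_rep U P X E -> measurable X.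
Proof. by exists E. Qed.

Lemma internal_measurable (E : iset T) : imeas E ->
  measurable (internal U E : set L).
Proof. by move=> mE; apply: loeb_rep_measurable; exact: loeb_rep_internal. Qed.

Lemma loeb_prob_internal (E : iset T) : imeas E ->
  loeb_prob (internal U E) = (imu U P E)%:E.
Proof. by move=> mE; apply: loeb_probE; exact: loeb_rep_internal. Qed.

Lemma loeb_null_measurable (X : set L) : loeb_null U P X -> measurable X.
Proof. by move=> nX; apply: loeb_rep_measurable (loeb_null_rep UF Uoo nX). Qed.

Lemma loeb_null_prob (X : set L) : loeb_null U P X -> loeb_prob X = 0%E.
Proof. by move=> nX; rewrite (loeb_probE (loeb_null_rep UF Uoo nX)) imu0. Qed.

Lemma loeb_null_measurable_eq (X Y : set L) :
  loeb_null U P [set w | ~ (X w <-> Y w)] -> measurable X -> measurable Y.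
Proof.
by move=> nXY /measurable_loeb_rep[E] /(loeb_rep_null UF Uoo nXY);
  exact: loeb_rep_measurable.
Qed.

(** The Loeb space is complete: a null set is represented by the empty internal set and is thus
    measurable. Almost-everywhere statements reduce in this way to covers by internal sets. *)
Lemma loeb_negligibleP (X : set L) :
  loeb_prob.-negligible X <-> loeb_null U P X.
Proof.
split; last by move=> nX; exists X; split;
  [exact: loeb_null_measurable|exact: loeb_null_prob|].
move=> [Y [/measurable_loeb_rep[E YE] Y0 XY]]; apply: loeb_null_sub XY _.
by apply: (loeb_rep0_null UF Uoo YE); apply: EFin_inj; rewrite -(loeb_probE YE).
Qed.

Lemma loeb_aeP (Q : L -> Prop) :
  {ae loeb_prob, forall w, Q w} <-> loeb_null U P [set w | ~ Q w].
Proof. exact: loeb_negligibleP. Qed.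

Lemma loeb_ae_near (Q : forall n, T n -> Prop) :
  (forall n, {ae P n, forall x, Q n x}) ->
  {ae loeb_prob, forall w, \forall n \near U, Q n (w n)}.
Proof.
move=> QP; apply/loeb_aeP.
have [E EP] := dep_choice QP.
apply: (@loeb_null_sub _ _ _ _ _ _ (internal U E)).
  move=> w /= /(ultraC UF) nQ; apply: filterS nQ => n nQ.
  by have [_ _] := EP n; apply.
apply: imu_loeb_null; first by move=> n; have [] := EP n.
rewrite /imu (_ : (fun n => _) = cst 0) ?ulim_cst//.
by apply/funext => n; have [_ -> _] := EP n.
Qed.

(** A sequence unbounded along [U] exceeds [K] at [U]-many coordinates, and by Markov's inequality
    this internal event has measure at most [C / K]. The [+ 1] in [K] keeps it positive when
    [C = 0]. *)
Lemma loeb_markov (f : forall n, T n -> R) (C : R) :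
  (forall n, measurable_fun setT (f n)) ->
  (forall n, \int[P n]_x `|(f n x)%:E| <= C%:E)%E ->
  {ae loeb_prob, forall w, ubounded U (fun n => f n (w n))}.
Proof.
move=> mf fC; apply/loeb_aeP => e e0.
pose K : R := (`|C| + 1) / e.
have K0 : 0 < K by rewrite divr_gt0// ltr_pwDr.
pose E : iset T := fun n => [set x | K <= `|f n x|].
have mE : imeas E.
  by move=> n; apply: measurable_ge; exact: measurableT_comp.
exists E; split => //.
- move=> w nb; apply: contrapT => /(ultraC UF) nE; apply: nb; exists K.
  by apply: filterS nE => n /negP; rewrite -ltNge => /ltW.
- apply: ulim_le_cst; first exact: ubounded_prob.
  near=> n; have := @le_integral_comp_abse _ _ _ (P n) _ measurableT
    (EFin \o f n) K id (@measurable_id _ _ _) (fun r => id) (fun x y _ _ => id).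
  rewrite setTI => /(_ _ K0) H.
  have {}H := H (proj2 (measurable_EFinP _ _) (mf n));
    have {H} := le_trans H (fC n).
  rewrite -[X in (_ * X)%E]/(P n (E n)).
  rewrite -[X in (_ * X <= _)%E -> _](@fineK _ (P n (E n))) ?fin_num_measure//.
  rewrite -EFinM lee_fin => KC.
  rewrite -(ler_pM2l K0) (le_trans KC)// /K divfK ?gt_eqF//.
  by rewrite (le_trans (ler_norm _))// lerDl.
Unshelve. all: by end_near. Qed.

End LoebSpace.

Arguments loeb_prob {R U} UF Uoo {d T} P X.

(** * Integration on the Loeb space *)

Section LoebFunctions.
Context (R : realType) (U : set_system nat) (UF : UltraFilter U)
  (Uoo : \oo `<=` U)
  (d : nat -> measure_display) (T : forall n, measurableType (d n))
  (P : forall n, probability (T n) R).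

Local Notation L := (loeb UF Uoo P).
Local Notation LP := (loeb_prob UF Uoo P).

Definition ulf (f : forall n, T n -> R) : L -> R :=
  fun w => ulim U (fun n => f n (w n)).

Definition ubf (f : forall n, T n -> R) : L -> Prop :=
  fun w => ubounded U (fun n => f n (w n)).

(** Where the sequence is bounded, the ultralimit exceeds [a] exactly when, for some [j], [U]-many
    terms exceed [a + 1 / (j + 1)]. The margin is needed because strict inequalities become weak in
    the limit. Superlevel sets are thus countable unions of internal sets up to a null set. *)
Lemma measurable_ulf (f : forall n, T n -> R) :
  (forall n, measurable_fun setT (f n)) -> {ae LP, forall w, ubf f w} ->
  measurable_fun setT (ulf f).
Proof.
move=> mf /loeb_aeP fb.
apply: (measurability _ (RGenOInfty.measurableE R)) => //.
move=> _ [_ [a ->] <-]; rewrite setTI.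
pose E j : iset T := fun n => [set x | a + j.+1%:R^-1 < f n x].
have mE j : imeas (E j) by move=> n; exact: measurable_gt.
apply: (@loeb_null_measurable_eq _ _ _ _ _ _ _ (\bigcup_j internal U (E j)));
  last first.
  by apply: bigcupT_measurable => j; exact: internal_measurable.
apply: loeb_null_sub fb => w /= nE wb; apply: nE; split.
  move=> [j _ Ew]; rewrite in_itv/= andbT.
  suff : a + j.+1%:R^-1 <= ulf f w by apply: lt_le_trans;
    rewrite ltrDl invr_gt0.
  by apply: ulim_ge_cst => //; apply: filterS Ew => n /ltW.
rewrite in_itv/= andbT -subr_gt0 => aw.
pose j := Num.truncn (ulf f w - a)^-1.
exists j => //; rewrite /internal/= /E/=; apply: ulim_gt => //.
rewrite -ltrBrDl invf_plt ?posrE//; exact: truncnS_gt.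
Qed.

Lemma ubf_bounded (f : forall n, T n -> R) (M : R) :
  (forall n x, `|f n x| <= M) -> forall w, ubf f w.
Proof. by move=> fM w; apply: (@ubounded_bnd _ _ _ _ M) => n; exact: fM. Qed.

(** Equality can fail, since [f n] may exceed [a] by an amount that vanishes in the limit. The bound
    from above is the direction that Fatou's lemma requires. *)
Lemma loeb_gt_le (f : forall n, T n -> R) (a : R) :
  (forall n, measurable_fun setT (f n)) -> {ae LP, forall w, ubf f w} ->
  (LP [set w | (a < ulf f w)%R] <=
   (imu U P (fun n => [set x | a < f n x]))%:E)%E.
Proof.
move=> mf fb; have mE : imeas (fun n => [set x | a < f n x]).
  by move=> n; exact: measurable_gt.
rewrite -loeb_prob_internal//.
have mA : measurable [set w | (a < ulf f w)%R].
  by apply: measurable_gt; exact: measurable_ulf.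
have mB := internal_measurable UF Uoo P mE.
move/loeb_aeP : fb => fb.
have mN := loeb_null_measurable fb.
apply: (@le_trans _ _ (LP (internal U (fun n =>
  [set x | a < f n x]) `|` [set w | ~ ubf f w]))).
  rewrite le_measure ?inE//; first exact: measurableU.
  move=> w /= aw; have [wb|wb] := pselect (ubf f w); last by right.
  by left; exact: ulim_gt.
rewrite (le_trans (measureU2 _ _ _))//.
by rewrite -[leRHS]adde0 -(loeb_null_prob fb).
Qed.

End LoebFunctions.

(** * Layer-cake sums *)

Section LayerSums.
Context (R : realType).
Implicit Types (h x : R) (K : nat).

(** A lower sum of the layer-cake formula, below [x] and within [h] of the minimum of [x] and
    [K%:R * h]. Its integral is a finite combination of measures of superlevel sets, and finite
    combinations commute with ultralimits. *)
Definition layers h K x : R := \sum_(j < K) h * ((j.+1%:R * h < x)%R : nat)%:R.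

Lemma layers_full h K x : 0 < h -> K%:R * h < x -> layers h K x = K%:R * h.
Proof.
move=> h0 Kx; rewrite /layers (eq_bigr (fun=> h)) => [|j _].
  by rewrite sumr_const card_ord mulr_natl.
rewrite (le_lt_trans _ Kx) ?mulr1// ler_pM2r// ler_nat; exact: ltn_ord.
Qed.

Lemma layersS h K x :
  layers h K.+1 x = layers h K x + h * ((K.+1%:R * h < x)%R : nat)%:R.
Proof. by rewrite /layers big_ord_recr. Qed.

Lemma layers_ge0 h K x : 0 < h -> 0 <= layers h K x.
Proof. by move=> h0; apply: sumr_ge0 => j _; rewrite mulr_ge0// ltW. Qed.

Lemma layers_le h K x : 0 < h -> 0 <= x -> layers h K x <= x.
Proof.
move=> h0 x0; elim: K => [|K IH]; first by rewrite /layers big_ord0.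
have [Kx|Kx] := ltP (K.+1%:R * h) x; first by rewrite layers_full// ltW.
by rewrite layersS ltNge Kx/= mulr0 addr0.
Qed.

Lemma layers_ge h K x : 0 < h -> 0 <= x ->
  Num.min x (K%:R * h) <= layers h K x + h.
Proof.
move=> h0 x0; elim: K => [|K IH].
  by rewrite /layers big_ord0 add0r mul0r ge_min (ltW h0) orbT.
have [Kx|Kx] := ltP (K.+1%:R * h) x;
  first by rewrite layers_full// (le_trans _ (_ :
  K.+1%:R * h <= _)) ?ge_min ?lexx ?orbT// lerDl ltW.
rewrite layersS [_ < x]ltNge Kx/= mulr0 addr0.
have [K'x|K'x] := ltP (K%:R * h) x.
  by rewrite layers_full// (le_trans Kx)// -natr1 mulrDl mul1r.
by move: IH; rewrite (min_idPl K'x).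
Qed.

Lemma integral_layers d (T : measurableType d) (P : probability T R)
    (f : T -> R) h K : 0 < h -> measurable_fun setT f ->
  (\int[P]_x (layers h K (f x))%:E =
   (\sum_(j < K) h * fine (P [set x | (j.+1%:R * h < f x)%R]))%:E)%E.
Proof.
move=> h0 mf; have mA (j : 'I_K) : measurable [set x | j.+1%:R * h < f x].
  exact: measurable_gt.
rewrite -sumEFin.
transitivity (\int[P]_x (\sum_(j < K) (h%:E * (\1_[set x | (j.+1%:R * h < f
  x)%R] x)%:E)))%E.
  apply: eq_integral => x _; rewrite /layers -sumEFin; apply: eq_bigr => j _.
  rewrite indicE -EFinM; congr (_ * _%:R)%:E.
  by congr nat_of_bool; apply/idP/idP; rewrite inE.
rewrite ge0_integral_sum//.
- apply: eq_bigr => j _; rewrite ge0_integralZl_EFin//; last by rewrite ltW.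
    by rewrite integral_indic// setIT EFinM fineK// fin_num_measure.
  by apply/measurable_EFinP; exact: measurable_indic.
- move=> j; apply/measurable_EFinP; apply: measurable_funM => //.
- by move=> j x _; rewrite -EFinM lee_fin mulr_ge0// ltW.
Qed.

End LayerSums.

(** * Fatou's lemma for ultralimits *)

Section LoebFatou.
Context (R : realType) (U : set_system nat) (UF : UltraFilter U)
  (Uoo : \oo `<=` U)
  (d : nat -> measure_display) (T : forall n, measurableType (d n))
  (P : forall n, probability (T n) R).

Local Notation L := (loeb UF Uoo P).
Local Notation LP := (loeb_prob UF Uoo P).
Local Notation ulf := (@ulf _ _ UF Uoo _ _ P).
Local Notation ubf := (@ubf _ _ UF Uoo _ _ P).

Lemma measurable_layers d' (T' : measurableType d') (f : T' -> R) h K :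
  measurable_fun setT f -> measurable_fun setT (fun x => layers h K (f x)).
Proof.
move=> mf; rewrite /layers; apply: measurable_sum => j.
apply: measurable_funM => //.
rewrite (_ : (fun x => _) = \1_[set x | j.+1%:R * h < f x]).
  by apply: measurable_indic; exact: measurable_gt.
apply/funext => x; rewrite indicE; congr (_%:R).
by congr nat_of_bool; apply/idP/idP; rewrite inE.
Qed.

Lemma loeb_layers_le (f : forall n, T n -> R) (C h : R) K : 0 < h ->
  (forall n, measurable_fun setT (f n)) -> (forall n x, 0 <= f n x) ->
  {ae LP, forall w, ubf f w} ->
  (\forall n \near U, (\int[P n]_x (f n x)%:E <= C%:E)%E) ->
  (\int[LP]_w (layers h K (ulf f w))%:E <= C%:E)%E.
Proof.
move=> h0 mf f0 fb fC.
rewrite integral_layers//; last exact: measurable_ulf.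
rewrite lee_fin.
pose E (j : nat) : iset T := fun n => [set x | j.+1%:R * h < f n x].
have mE j : imeas (E j) by move=> n; exact: measurable_gt.
have bE j : ubounded U (fun n => h * fine (P n (E j n))).
  apply: uboundedM; last exact: ubounded_prob.
  exact: (@ubounded_bnd _ _ _ _ `|h|).
have sumE k : ubounded U (fun n => \sum_(j < k) h * fine (P n (E j n))) /\
    ulim U (fun n => \sum_(j < k) h * fine (P n (E j n))) = \sum_(j < k) h *
      imu U P (E j).
  elim: k => [|k [IHb IHs]].
    under eq_fun do rewrite big_ord0; rewrite big_ord0 ulim_cst; split => //.
    by apply: (@ubounded_bnd _ _ _ _ 0) => n; rewrite normr0.
  under eq_fun do rewrite big_ord_recr; split; first exact: uboundedD.
  rewrite ulimD// IHs big_ord_recr/= ulimM ?ulim_cst//;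
    last exact: ubounded_prob.
  exact: (@ubounded_bnd _ _ _ _ `|h|).
apply: (@le_trans _ _ (\sum_(j < K) h * imu U P (E j))).
  apply: ler_sum => j _; rewrite ler_pM2l//.
  rewrite -lee_fin fineK ?fin_num_measure//; first exact: loeb_gt_le.
  by apply: measurable_gt; exact: measurable_ulf.
have [bS <-] := sumE K.
apply: ulim_le_cst => //; apply: filterS fC => n; rewrite -lee_fin;
  apply: le_trans.
rewrite -integral_layers//; apply: ge0_le_integral => //.
- by move=> x _; rewrite lee_fin layers_ge0.
- by apply/measurable_EFinP; exact: measurable_layers.
- by apply/measurable_EFinP.
- by move=> x _; rewrite lee_fin layers_le.
Qed.

(** The truncation of the limit at height [k] is at most a layer sum plus [h], once [K] layers of
    height [h] reach [k]. This gives the bound [C + h] for the truncation; letting [h] tend to 0 and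
    then [k] to infinity, by monotone convergence, gives [C]. *)
Lemma loeb_fatou (f : forall n, T n -> R) (C : R) :
  (forall n, measurable_fun setT (f n)) -> (forall n x, 0 <= f n x) ->
  {ae LP, forall w, ubf f w} ->
  (\forall n \near U, (\int[P n]_x (f n x)%:E <= C%:E)%E) ->
  (\int[LP]_w `|(ulf f w)%:E| <= C%:E)%E.
Proof.
move=> mf f0 fb fC; have mg := measurable_ulf mf fb.
have g0 : {ae LP, forall w, (0 <= ulf f w)%R}.
  apply: filterS fb => w wb; apply: ulim_ge_cst => //.
  by apply: filterS filterT => n _; exact: f0.
(* The maximum discards default values of [ulf f], possibly negative, on the null set where the
   sequence is unbounded. *)
pose g w := Num.max 0 (ulf f w).
have mg' : measurable_fun setT g by exact: measurable_maxr.
have -> : (\int[LP]_w `|(ulf f w)%:E| = \int[LP]_w (g w)%:E)%E.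
  apply: ae_eq_integral => //.
  - by apply: measurableT_comp => //; exact/measurable_EFinP.
  - exact/measurable_EFinP.
  - apply: filterS g0 => w w0 _ /=; rewrite ger0_norm// /g.
    by rewrite (max_idPr w0).
have gpos w : 0 <= g w by rewrite le_max lexx.
pose gK (k : nat) w : R := Num.min (g w) k%:R.
have mgK k : measurable_fun setT (gK k) by exact: measurable_minr.
have gK0 k w : 0 <= gK k w by rewrite le_min gpos/=.
have gKC k (h : R) : 0 < h -> (\int[LP]_w (gK k w)%:E <= (C + h)%:E)%E.
  move=> h0; pose K := (Num.truncn (k%:R / h)).+1.
  have Kh : k%:R <= K%:R * h by rewrite -ler_pdivrMr// ltW// truncnS_gt.
  apply: (@le_trans _ _ (\int[LP]_w ((layers h K (ulf f w))%:E + h%:E))%E).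
    apply: ge0_le_integral => //.
    - by move=> w _; rewrite lee_fin.
    - exact/measurable_EFinP.
    - by apply/measurable_EFinP; apply: measurable_funD => //;
      exact: measurable_layers.
    - move=> w _; rewrite -EFinD lee_fin.
      have -> : layers h K (ulf f w) = layers h K (g w).
        apply: eq_bigr => j _; congr (_ * (nat_of_bool _)%:R).
        by rewrite /g lt_max [_ < 0]ltNge mulr_ge0//= ltW.
      apply: le_trans (layers_ge _ h0 (gpos w)).
      by rewrite /gK le_min !ge_min lexx/= Kh orbT.
  rewrite ge0_integralD//.
  - rewrite integral_cst//= [X in (_ * X)%E](@probability_setT _ _ _ LP) mule1
    EFinD leeD2r//.
    exact: loeb_layers_le.
  - by move=> w _; rewrite lee_fin layers_ge0.
  - by apply/measurable_EFinP; exact: measurable_layers.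
  - by move=> w _; rewrite lee_fin ltW.
have gKle k : (\int[LP]_w (gK k w)%:E <= C%:E)%E.
  by apply/lee_addgt0Pr => h h0; rewrite -EFinD; exact: gKC.
have cv : (\int[LP]_w (gK k w)%:E @[k --> \oo] --> \int[LP]_w (g w)%:E)%E.
  have glim w : limn (fun k => (gK k w)%:E) = (g w)%:E.
    apply: cvg_lim => //; apply/cvg_EFin; first by near=> k.
    apply: cvg_near_cst; near=> k.
    apply/min_idPl; apply/ltW; near: k; exact: nbhs_infty_gtr.
  have -> : (\int[LP]_w (g w)%:E = \int[LP]_w limn (fun k => (gK k w)%:E))%E.
    by apply: eq_integral => w _; rewrite glim.
  apply: (@cvg_monotone_convergence _ _ _ LP setT measurableT (fun k w =>
    (gK k w)%:E)).
  - by move=> k; apply/measurable_EFinP.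
  - by move=> k w _; rewrite lee_fin.
  - move=> w _ i j ij; rewrite lee_fin /gK le_min ge_min lexx/= ge_min ler_nat
    ij orbT//.
rewrite -(cvg_lim _ cv)//; apply: lime_le; first by apply/cvg_ex; eexists;
  exact: cv.
by near=> k.
Unshelve. all: by end_near. Qed.

End LoebFatou.

(** * Norms *)

Section Norms.
Context (R : realType) d (T : measurableType d) (P : probability T R).
Implicit Types f g : T -> R.

Lemma measurable_norm_powR f (r : R) : measurable_fun setT f ->
  measurable_fun setT (fun x => `|f x| `^ r).
Proof.
move=> mf; apply: (@measurableT_comp _ _ _ _ _ _ (@powR R ^~ r)) => //.
exact: measurableT_comp.
Qed.

Lemma powR_le_powR (x y r : R) : 0 < r -> 0 <= x -> 0 <= y ->
  (x `^ r <= y `^ r) = (x <= y).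
Proof.
move=> r0 x0 y0; apply/idP/idP; last by move=> xy; apply: ge0_ler_powR => //;
  exact: ltW.
by apply: contraTT; rewrite -!ltNge => yx; exact: gt0_ltr_powR.
Qed.

Lemma poweR_Lnorm_EFin f (r : R) : 0 < r ->
  (Lnorm P r%:E (EFin \o f) `^ r = \int[P]_x (`|f x| `^ r)%:E)%E.
Proof. by move=> r0; rewrite poweR_Lnorm ?gt_eqF. Qed.

Lemma Lnorm_leP f (r K : R) : 0 < r -> 0 <= K ->
  (Lnorm P r%:E (EFin \o f) <= K%:E)%E =
  (\int[P]_x (`|f x| `^ r)%:E <= (K `^ r)%:E)%E.
Proof.
move=> r0 K0; rewrite -poweR_Lnorm_EFin//.
have := Lnorm_ge0 P r%:E (EFin \o f); case: (Lnorm _ _ _) => [x|_|//].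
  by rewrite poweR_EFin !lee_fin => x0; rewrite powR_le_powR.
by rewrite poweRyr ?gt_eqF// !leye_eq.
Qed.

Lemma Lnorm_ltP f (r K : R) : 0 < r -> 0 <= K ->
  (Lnorm P r%:E (EFin \o f) < K%:E)%E =
  (\int[P]_x (`|f x| `^ r)%:E < (K `^ r)%:E)%E.
Proof.
move=> r0 K0; rewrite -poweR_Lnorm_EFin//.
have := Lnorm_ge0 P r%:E (EFin \o f); case: (Lnorm _ _ _) => [x|_|//].
  rewrite poweR_EFin lee_fin !lte_fin => x0.
  by rewrite !ltNge powR_le_powR.
by rewrite poweRyr ?gt_eqF.
Qed.

Lemma Lnormy f : Lnorm P +oo%E (EFin \o f) = ess_sup P (abse \o (EFin \o f)).
Proof. by rewrite unlock /Lnorm [X in (0 < X)%E](@probability_setT _ _ _ P)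
  lte01. Qed.

Lemma Lnormy_leP f (K : \bar R) :
  (Lnorm P +oo%E (EFin \o f) <= K)%E <-> {ae P, forall x, (`|(f x)%:E| <= K)%E}.
Proof. by rewrite Lnormy; split => [/ess_supP|h]; [|apply/ess_supP]. Qed.

Lemma ae_eq_Lnorm f g (q : \bar R) : (0 < q)%E ->
  measurable_fun setT f -> measurable_fun setT g ->
  {ae P, forall x, f x = g x} -> Lnorm P q (EFin \o f) = Lnorm P q (EFin \o g).
Proof.
case: q => [r|_|//] => [r0|] mf mg fg.
  rewrite unlock /Lnorm; congr (_ `^ _)%E.
  apply: (@ae_eq_integral _ _ _ P setT) => //.
  - rewrite (_ : (fun x => _) = EFin \o (fun x => `|f x| `^ r))//.
    by apply/measurable_EFinP; exact: measurable_norm_powR.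
  - rewrite (_ : (fun x => _) = EFin \o (fun x => `|g x| `^ r))//.
    by apply/measurable_EFinP; exact: measurable_norm_powR.
  - by apply: filterS fg => x fgx _; rewrite /= fgx.
rewrite !Lnormy; apply: eq_ess_sup.
by apply: filterS fg => x /= ->.
Qed.

(** For finite [q] this is Hölder's inequality against the constant 1, with conjugate exponent [r'];
    for infinite [q] the function is almost everywhere below its essential supremum. The total mass
    is 1 in both cases. *)
Lemma Lnorm1_le f (q : \bar R) : (1%:E < q)%E -> measurable_fun setT f ->
  (Lnorm P 1%:E (EFin \o f) <= Lnorm P q (EFin \o f))%E.
Proof.
case: q => [r||//] => [r1|_] mf.
  rewrite lte_fin in r1; have r0 : 0 < r by exact: lt_trans r1.
  pose r' := (1 - r^-1)^-1.
  have r'0 : 0 < r' by rewrite invr_gt0 subr_gt0 invf_lt1.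
  have := @hoelder _ _ _ P f (cst 1) r r' mf (@measurable_cst _ _ _ _ _ _) r0
    r'0.
  rewrite invrK addrC subrK => /(_ erefl).
  rewrite (_ : f \* cst 1 = f); last by apply/funext => x /=; rewrite mulr1.
  rewrite (_ : Lnorm P r'%:E _ = 1%E) ?mule1//.
  rewrite (_ : EFin \o cst 1 = cst 1%E)// Lnorm_cst1 [X in (X `^
    _)%E](@probability_setT _ _ _ P).
  by rewrite poweR1r.
rewrite Lnorm1 Lnormy; set s := ess_sup _ _.
have : {ae P, forall x, (`|(f x)%:E| <= s)%E} by exact: ess_sup_ge.
have : (0 <= s)%E by rewrite /s -Lnormy Lnorm_ge0.
case: s => [s|_ _|//]; last by rewrite leey.
move=> s0 fs; apply: (@le_trans _ _ (\int[P]_x s%:E)%E).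
  apply: ae_ge0_le_integral => //.
  - by apply: measurableT_comp => //; exact/measurable_EFinP.
  - by apply: filterS fs => x + _.
by rewrite integral_cst//= [X in (_ * X)%E](@probability_setT _ _ _ P) mule1.
Qed.

Lemma Linf_Lnorm_fin f (r : R) : 1 <= r -> Linf_fun P f ->
  Lnorm P r%:E (EFin \o f) \is a fin_num.
Proof.
move=> r1 [mf [M fM]].
have r0 : 0 < r by exact: lt_le_trans r1.
have M0 : 0 <= Num.max M 0 by rewrite le_max lexx orbT.
rewrite ge0_fin_numE ?Lnorm_ge0// (@le_lt_trans _ _ (Num.max M 0)%:E) ?ltry//.
rewrite Lnorm_leP//; apply: (@le_trans _ _ (\int[P]_x (Num.max M 0 `^ r)%:E)%E).
  apply: ae_ge0_le_integral => //.
  - by apply/measurable_EFinP; exact: measurable_norm_powR.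
  - by move=> x _; rewrite lee_fin powR_ge0.
  - apply: filterS fM => x fx _; rewrite lee_fin powR_le_powR//.
    by rewrite le_max fx.
by rewrite integral_cst//= [X in (_ * X)%E](@probability_setT _ _ _ P) mule1.
Qed.

Lemma Linf_Lnorm_bnd f (r M : R) : 1 <= r -> measurable_fun setT f -> 0 <= M ->
  (forall x, `|f x| <= M) -> (Lnorm P r%:E (EFin \o f) <= M%:E)%E.
Proof.
move=> r1 mf M0 fM; have r0 : 0 < r by exact: lt_le_trans r1.
rewrite Lnorm_leP//; apply: (@le_trans _ _ (\int[P]_x (M `^ r)%:E)%E).
  apply: ge0_le_integral => //.
  - by apply/measurable_EFinP; exact: measurable_norm_powR.
  - by move=> x _; rewrite lee_fin powR_le_powR.
by rewrite integral_cst//= [X in (_ * X)%E](@probability_setT _ _ _ P) mule1.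
Qed.

Lemma Lnorm_ley f (r : R) : 1 <= r -> measurable_fun setT f ->
  (Lnorm P r%:E (EFin \o f) <= Lnorm P +oo%E (EFin \o f))%E.
Proof.
move=> r1 mf; have r0 : 0 < r by exact: lt_le_trans r1.
case fx : (Lnorm P +oo%E (EFin \o f)) (Lnorm_ge0 P +oo%E (EFin \o f)) =>
  [x| |]//.
  rewrite lee_fin => x0.
  have /Lnormy_leP fle : (Lnorm P +oo%E (EFin \o f) <= x%:E)%E by rewrite fx.
  rewrite Lnorm_leP//; apply: (@le_trans _ _ (\int[P]_w (x `^ r)%:E)%E).
    apply: ae_ge0_le_integral => //.
    - by apply/measurable_EFinP; exact: measurable_norm_powR.
    - by move=> w _; rewrite lee_fin powR_ge0.
    - by apply: filterS fle => w; rewrite lee_fin => vw _;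
      rewrite lee_fin powR_le_powR.
  by rewrite integral_cst//= [X in (_ * X)%E](@probability_setT _ _ _ P) mule1.
by move=> _; rewrite leey.
Qed.

Lemma Linf_bnd f (M : R) : measurable_fun setT f -> (forall x, `|f x| <= M) ->
  Linf_fun P f.
Proof. by move=> mf fM; split => //; exists M; apply: aeW. Qed.

Lemma Linf_lin (a : R) f g : Linf_fun P f -> Linf_fun P g ->
  Linf_fun P (fun x => a * f x + g x).
Proof.
move=> [mf [M fM]] [mg [N gN]]; split.
  by apply: measurable_funD => //; exact: measurable_funM.
exists (`|a| * M + N); near=> x; rewrite (le_trans (ler_normD _ _))// lerD//.
  by rewrite normrM ler_wpM2l//; near: x.
by near: x.
Unshelve. all: by end_near. Qed.

Lemma Linf_cst (a : R) : Linf_fun P (fun=> a).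
Proof. by apply: (@Linf_bnd _ `|a|). Qed.

Variables (A : Poperator P) (p c : R) (q : \bar R).
Hypotheses (c0 : 0 < c) (p1 : 1 <= p) (q1 : (1%:E < q)%E).
Hypothesis Ac : (opnorm P A p%:E q <= c%:E)%E.

Lemma Pop_eq0 f : Linf_fun P f -> {ae P, forall x, f x = 0} ->
  {ae P, forall x, A f x = 0}.
Proof.
move=> Lf f0.
have A0 : {ae P, forall x, A (fun=> 0) x = 0}.
  (* Linearity applied to two zero functions reads [A 0 = A 0 + A 0] almost everywhere. *)
  have := Pop_lin A 1 (Linf_cst 0) (Linf_cst 0).
  rewrite (_ : (fun y => _) = fun=> 0); last by apply/funext => y;
    rewrite mulr0 addr0.
  apply: filterS => x; rewrite mul1r => /eqP.
  by rewrite -subr_eq0 opprD addrA subrr sub0r oppr_eq0 => /eqP.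
have := Pop_ae A Lf (Linf_cst 0) f0.
by apply: filterS2 A0 => x -> ->.
Qed.

(** The supremum in [opnorm] ranges over functions of nonzero norm only, so functions of norm 0 are
    treated apart: they vanish almost everywhere, and so do their images. *)
Lemma Pop_bound f (K : R) : 0 < K -> Linf_fun P f ->
  (Lnorm P p%:E (EFin \o f) <= K%:E)%E ->
    (Lnorm P q (EFin \o A f) <= (c * K)%:E)%E.
Proof.
move=> K0 Lf fK; have p0 : 0 < p by exact: lt_le_trans p1.
have q0 : (0 < q)%E by apply: lt_trans q1; rewrite lte_fin.
have [f0|f0] := eqVneq (Lnorm P p%:E (EFin \o f)) 0%E.
  have /(Pop_eq0 Lf) Af0 : {ae P, forall x, f x = 0}.
    have := Lnorm_eq0_eq0 _ _ f0; rewrite lte_fin => /(_ _ p0) H.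
    have : (EFin \o f = \0 %[ae P])%E by apply: H; apply/measurable_EFinP;
      case: Lf.
    by apply: filterS => x /(_ I) /= [].
  rewrite (@ae_eq_Lnorm _ (fun=> 0) q)//; last exact: Pop_meas.
  rewrite (_ : EFin \o _ = cst 0%E)// Lnorm0 ?gt_eqF//.
  by rewrite lee_fin mulr_ge0// ltW.
pose x := fine (Lnorm P p%:E (EFin \o f)).
have fx : Lnorm P p%:E (EFin \o f) = x%:E by rewrite fineK//;
  exact: Linf_Lnorm_fin.
have x0 : 0 < x by rewrite -lte_fin -fx lt_neqAle eq_sym f0 Lnorm_ge0.
rewrite fx in fK.
have : (Lnorm P q (EFin \o A f) * (x^-1)%:E <= c%:E)%E.
  apply: le_trans Ac; apply: ereal_sup_ubound; exists f; last by rewrite -/x.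
  by split.
rewrite -lee_pdivlMr ?invr_gt0// => /le_trans; apply.
by rewrite lee_fin invrK ler_pM2l// -lee_fin.
Qed.

Lemma Pop_bound1 f (K : R) : 0 < K -> Linf_fun P f ->
  (Lnorm P p%:E (EFin \o f) <= K%:E)%E ->
    (\int[P]_x `|(A f x)%:E| <= (c * K)%:E)%E.
Proof.
move=> K0 Lf fK; rewrite -(Lnorm1 P (EFin \o A f)).
by apply: le_trans (Pop_bound K0 Lf fK); apply: Lnorm1_le => //;
  exact: Pop_meas.
Qed.

End Norms.

(** * Norms of ultralimits *)

Section LoebNorms.
Context (R : realType) (U : set_system nat) (UF : UltraFilter U)
  (Uoo : \oo `<=` U)
  (d : nat -> measure_display) (T : forall n, measurableType (d n))
  (P : forall n, probability (T n) R).

Local Notation L := (loeb UF Uoo P).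
Local Notation LP := (loeb_prob UF Uoo P).
Local Notation ulf := (@ulf _ _ UF Uoo _ _ P).
Local Notation ubf := (@ubf _ _ UF Uoo _ _ P).

(** Fatou's lemma reversed, for uniformly bounded functions: were the integrals of [f n] above [C]
    for [U]-many [n], those of [M - f n] would be at most [M - C], and Fatou's lemma would force the
    integral of the limit to be at least [C]. *)
Lemma loeb_integral_lt (f : forall n, T n -> R) (M C : R) :
  (forall n, measurable_fun setT (f n)) -> (forall n x, 0 <= f n x <= M) ->
  (\int[LP]_w (ulf f w)%:E < C%:E)%E ->
  \forall n \near U, (\int[P n]_x (f n x)%:E <= C%:E)%E.
Proof.
move=> mf fM; rewrite ltNge => /negP; apply: contra_notP => /(ultraC UF) Cf.
have f0 n x : 0 <= f n x by have /andP[] := fM n x.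
have fM' n x : f n x <= M by have /andP[] := fM n x.
have fb : {ae LP, forall w, ubf f w}.
  by apply: aeW => w; apply: (ubf_bounded (M := M)) => n x; rewrite ger0_norm.
pose g n x := M - f n x.
have mg n : measurable_fun setT (g n) by exact: measurable_funB.
have g0 n x : 0 <= g n x by rewrite subr_ge0.
have gb : {ae LP, forall w, ubf g w}.
  apply: aeW => w; apply: (ubf_bounded (M := M)) => n x.
  by rewrite ger0_norm// gerBl.
have gE w : ulf g w = M - ulf f w.
  rewrite /ulf /g (@ulimD _ _ UF (fun=> M) (fun n => - f n (w n))).
  - rewrite ulim_cst; congr (_ + _);
    rewrite -mulN1r -[X in X * _](@ulim_cst _ _ UF).
    rewrite -ulimM//; last 2 first.
    + exact: (@ubounded_bnd _ _ _ _ `|-1|).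
    + by apply: (ubf_bounded (M := M)) => n x; rewrite ger0_norm.
    by congr ulim; apply/funext => n; rewrite mulN1r.
  - exact: (@ubounded_bnd _ _ _ _ `|M|).
  - by apply: (@ubounded_bnd _ _ _ _ M) => n; rewrite normrN ger0_norm.
have ulf0 w : 0 <= ulf f w.
  apply: ulim_ge_cst; last by apply: filterS filterT => n _.
  by apply: (ubf_bounded (M := M)) => n x; rewrite ger0_norm.
have ulfM w : ulf f w <= M.
  apply: ulim_le_cst; last by apply: filterS filterT => n _.
  by apply: (ubf_bounded (M := M)) => n x; rewrite ger0_norm.
have mulf := measurable_ulf mf fb.
have intB d' (T' : measurableType d') (Q : probability T' R) (h : T' -> R) :
    measurable_fun setT h -> (forall x, 0 <= h x) -> (forall x, h x <= M) ->
    (\int[Q]_x (M - h x)%:E + \int[Q]_x (h x)%:E = M%:E)%E.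
  move=> mh h0 hM; rewrite -ge0_integralD//.
  - under eq_integral do rewrite -EFinD subrK.
    by rewrite integral_cst//= [X in (_ * X)%E](@probability_setT _ _ _ Q)
      mule1.
  - by move=> x _; rewrite lee_fin subr_ge0.
  - by apply/measurable_EFinP; exact: measurable_funB.
  - by move=> x _; rewrite lee_fin.
  - exact/measurable_EFinP.
have gC : \forall n \near U, (\int[P n]_x (g n x)%:E <= (M - C)%:E)%E.
  apply: filterS Cf => n /negP; rewrite -ltNge => Cf.
  rewrite EFinB leeBrDr// -(intB _ _ (P n) (f n))// leeD2l//.
  exact: ltW.
have := loeb_fatou mg g0 gb gC.
rewrite (eq_integral (fun w => (M - ulf f w)%:E)); last first.
  by move=> w _; rewrite gE gee0_abs// lee_fin subr_ge0.
rewrite EFinB leeBrDr// -(intB _ _ LP (ulf f))// leeD2lE//.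
rewrite ge0_fin_numE; last by apply: integral_ge0 => w _;
  rewrite lee_fin subr_ge0.
rewrite (@le_lt_trans _ _ M%:E) ?ltry// -(intB _ _ LP (ulf f))// leeDl//.
by apply: integral_ge0 => w _; rewrite lee_fin.
Qed.

Lemma ulim_norm (u : nat -> R) : ubounded U u ->
  ulim U (fun n => `|u n|) = `|ulim U u|.
Proof. by move=> /(cvg_ulim UF) uc; apply: ulim_eq; exact: cvg_norm. Qed.

(** Only monotonicity of the power function is used: the limit of the powers is itself written as an
    [r]-th power, and the two bases are compared. *)
Lemma ulim_powR (u : nat -> R) (r : R) : 0 < r -> (forall n, 0 <= u n) ->
  ubounded U u -> ubounded U (fun n => u n `^ r) /\
  ulim U (fun n => u n `^ r) = ulim U u `^ r.
Proof.
move=> r0 u0 bu.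
have bv : ubounded U (fun n => u n `^ r).
  have [M uM] := bu; exists (`|M| `^ r); apply: filterS uM => n uM.
  rewrite ger0_norm ?powR_ge0// powR_le_powR//.
  by rewrite -[leLHS]ger0_norm// (le_trans uM)// ler_norm.
split=> //; set l := ulim U u; set l' := ulim U _.
have l0 : 0 <= l by apply: ulim_ge_cst => //; apply: filterS filterT => n _.
have l'0 : 0 <= l'.
  by apply: ulim_ge_cst => //; apply: filterS filterT => n _; exact: powR_ge0.
have l'E : l' = (l' `^ r^-1) `^ r by rewrite -powRrM mulVf ?gt_eqF// powRr1.
rewrite l'E; congr (_ `^ _); apply/eqP; rewrite eq_le; apply/andP; split.
  apply/ler_addgt0Pr => e e0.
  have le0 : 0 <= l + e by rewrite addr_ge0// ltW.
  rewrite -(powR_le_powR r0) ?powR_ge0// -l'E.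
  apply: ulim_le_cst => //.
  have : \forall n \near U, u n < l + e by apply: ulim_lt => //; rewrite ltrDl.
  by apply: filterS => n /ltW ule; rewrite powR_le_powR.
rewrite leNgt; apply/negP => ll.
pose m := (l' `^ r^-1 + l) / 2.
have m0 : 0 <= m by rewrite divr_ge0// addr_ge0// powR_ge0.
have : m `^ r <= l'.
  apply: ulim_ge_cst => //.
  have : \forall n \near U, m < u n by apply: ulim_gt => //; rewrite midf_lt.
  by apply: filterS => n /ltW ule; rewrite powR_le_powR.
rewrite l'E powR_le_powR ?powR_ge0// leNgt => /negP; apply.
by rewrite midf_lt.
Qed.

Lemma loeb_Lnorm_fatou (f : forall n, T n -> R) (q : \bar R) (C : R) :
  (0 < q)%E -> 0 <= C ->
  (forall n, measurable_fun setT (f n)) -> {ae LP, forall w, ubf f w} ->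
  (\forall n \near U, (Lnorm (P n) q (EFin \o f n) <= C%:E)%E) ->
  (Lnorm LP q (EFin \o ulf f) <= C%:E)%E.
Proof.
case: q => [r|_|//] => [r0|] C0 mf fb fC; have mulf := measurable_ulf mf fb.
  rewrite lte_fin in r0.
  rewrite Lnorm_leP//.
  pose g n x := `|f n x| `^ r.
  have mg n : measurable_fun setT (g n) by exact: measurable_norm_powR.
  have gE w : ubf f w -> ubf g w /\ ulf g w = `|ulf f w| `^ r.
    move=> fw; rewrite /ulf -ulim_norm//; apply: ulim_powR => //.
    by have [M fM] := fw; exists M; apply: filterS fM => n; rewrite normr_id.
  have := @loeb_fatou _ _ UF Uoo _ _ P g (C `^ r) mg.
  rewrite (ae_eq_integral (fun w => (`|ulf f w| `^ r)%:E)) //; last 3 first.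
  - apply: measurableT_comp => //; apply/measurable_EFinP;
    apply: measurable_ulf => //.
    by apply: filterS fb => w /gE[].
  - by apply/measurable_EFinP; exact: measurable_norm_powR.
  - by apply: filterS fb => w /gE[_ ->] _; rewrite gee0_abs// lee_fin powR_ge0.
  apply; first by move=> n x; exact: powR_ge0.
    by apply: filterS fb => w /gE[].
  by apply: filterS fC => n; rewrite Lnorm_leP.
apply/Lnormy_leP.
(* The norm bound is available for [U]-many [n] only, while the transfer principle wants a statement
   at every [n]; the bound is therefore made a premise. *)
have := @loeb_ae_near _ _ UF Uoo _ _ P
  (fun n x => (Lnorm (P n) +oo%E (EFin \o f n) <= C%:E)%E ->
    (`|(f n x)%:E| <= C%:E)%E).
have H n : {ae P n, forall x,
    (Lnorm (P n) +oo (EFin \o f n) <= C%:E)%E -> (`|(f n x)%:E| <= C%:E)%E}.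
  have [fnC|fnC] := pselect (Lnorm (P n) +oo (EFin \o f n) <= C%:E)%E.
    by move/Lnormy_leP : (fnC); apply: filterS.
  by apply: aeW.
move=> /(_ H); apply: filterS2 fb => w fw fCw.
rewrite -[(`|_|)%E]/(`|ulf f w|)%:E lee_fin -ulim_norm//; apply: ulim_le_cst.
  by have [M fM] := fw; exists M; apply: filterS fM => n; rewrite normr_id.
by apply: filterS2 fC fCw => n fnC /(_ fnC); rewrite lee_fin.
Qed.

Lemma loeb_Lnorm_lt (f : forall n, T n -> R) (p K M : R) :
  0 < p -> 0 <= K -> (forall n, measurable_fun setT (f n)) ->
  (forall n x, `|f n x| <= M) ->
  (Lnorm LP p%:E (EFin \o ulf f) < K%:E)%E ->
  \forall n \near U, (Lnorm (P n) p%:E (EFin \o f n) <= K%:E)%E.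
Proof.
move=> p0 K0 mf fM; rewrite Lnorm_ltP// => fK.
pose g n x := `|f n x| `^ p.
have M0 : 0 <= M by rewrite (le_trans _ (fM 0 point)).
have gE w : ulf g w = `|ulf f w| `^ p.
  have fw : ubf f w by exact: ubf_bounded fM _.
  rewrite /ulf -ulim_norm//; apply: (proj2 (ulim_powR _ _ _)) => //.
  by have [N fN] := fw; exists N; apply: filterS fN => n; rewrite normr_id.
have : \forall n \near U, (\int[P n]_x (g n x)%:E <= (K `^ p)%:E)%E.
  apply: (@loeb_integral_lt _ (M `^ p)).
  - by move=> n; exact: measurable_norm_powR.
  - by move=> n x; rewrite powR_ge0/= powR_le_powR.
  - by under eq_integral do rewrite gE.
by apply: filterS => n; rewrite Lnorm_leP.
Qed.

End LoebNorms.

(** * The ultraproduct of P-operators *)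

Section LoebLift.
Context (R : realType) (U : set_system nat) (UF : UltraFilter U)
  (Uoo : \oo `<=` U)
  (d : nat -> measure_display) (T : forall n, measurableType (d n))
  (P : forall n, probability (T n) R).

Local Notation L := (loeb UF Uoo P).
Local Notation LP := (loeb_prob UF Uoo P).
Local Notation ulf := (@ulf _ _ UF Uoo _ _ P).
Local Notation ubf := (@ubf _ _ UF Uoo _ _ P).

(** The bound holds at every point, so [ulf f] never meets a default value, and it is uniform in
    [n], as the reversed Fatou lemma requires. *)
Definition is_lift (M : R) (v : L -> R) (f : forall n, T n -> R) :=
  [/\ forall n, measurable_fun setT (f n), forall n x, `|f n x| <= M &
      {ae LP, forall w, ulf f w = v w}].

(* The binary digits of g are indicators of measurable sets; lifting each of
   these to an internal set lifts g. *)
Lemma loeb_lift01 (g : L -> R) : measurable_fun setT g ->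
  (forall w, 0 <= g w <= 1) ->
  exists f : forall n, T n -> R, [/\ forall n, measurable_fun setT (f n),
    forall n x, 0 <= f n x <= 1 & {ae LP, forall w, ulf f w = g w}].
Proof.
move=> mg g01.
pose h (j : nat) : R := (2 ^+ j.+1)^-1.
have h0 j : 0 < h j by rewrite invr_gt0 exprn_gt0.
have hS j : (2 ^+ j)^-1 = h j + h j :> R.
  by rewrite /h exprS invfM mulrC -splitr.
(* [r j] is what remains of [g] after [j] binary digits; the next digit is 1 where the remainder is
   at least [h j]. *)
pose r := fix r (j : nat) (w : L) : R :=
  if j is i.+1 then r i w - h i * \1_[set w | h i <= r i w] w else g w.
have mr j : measurable_fun setT (r j).
  elim: j => [//|j IH]; apply: measurable_funB => //;
    apply: measurable_funM => //.
  by apply: measurable_indic; exact: measurable_ge.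
have r01 j w : 0 <= r j w <= (2 ^+ j)^-1.
  elim: j => [|j /andP[IH0 IH1]]; first by rewrite expr0 invr1.
  rewrite /= -/(h j) indicE; have [hr|hr] := leP (h j) (r j w).
    rewrite mem_set// mulr1 subr_ge0 hr/= lerBlDr.
    by rewrite (le_trans IH1)// hS.
  by rewrite memNset ?mulr0 ?subr0 ?IH0 ?ltW//= leNgt hr.
pose X j : set L := [set w | h j <= r j w].
have /choice[E XE] : forall j, exists E, loeb_rep U P (X j) E.
  by move=> j; apply: measurable_loeb_rep; exact: measurable_ge.
have mE j : imeas (E j) by have [] := XE j.
have gE k w : g w = \sum_(j < k) h j * \1_(X j) w + r k w.
  elim: k => [|k IH]; first by rewrite big_ord0 add0r.
  rewrite big_ord_recr/= -/(X k) {1}IH -addrA; congr (_ + _).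
  by rewrite addrC subrK.
(* Coordinate [n] uses only the first [n] digits, which keeps the sum finite; no digit is lost in
   the limit, since [n] exceeds any given [k] along [U]. *)
pose f n (x : T n) : R := \sum_(j < n) h j * \1_(E j n) x.
have tail n k (a : nat -> R) : (k <= n)%N -> (forall j, 0 <= a j <= 1) ->
    0 <= \sum_(k <= j < n) h j * a j <= (2 ^+ k)^-1 - (2 ^+ n)^-1.
  move=> kn a01; apply/andP; split.
    by apply: sumr_ge0 => j _; apply: mulr_ge0;
      [exact: ltW|have /andP[] := a01 j].
  elim: n kn => [|n IH]; first by rewrite leqn0 => /eqP ->;
    rewrite big_geq// subrr.
  rewrite leq_eqVlt => /predU1P[->|]; first by rewrite big_geq// subrr.
  rewrite ltnS => kn; rewrite big_nat_recr//=.
  have := lerD (IH kn) (_ : h n * a n <= h n).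
  have -> : (2 ^+ k)^-1 - (2 ^+ n)^-1 + h n = (2 ^+ k)^-1 - (2 ^+ n.+1)^-1.
    by rewrite (hS n) -/(h n) opprD addrA subrK.
  by apply; rewrite ler_piMr//; [exact: ltW|have /andP[] := a01 n].
have ind01 (S : Type) (A : set S) x : 0 <= (\1_A x : R) <= 1.
  by rewrite indicE; case: (x \in A); rewrite ?lexx ?ler01.
exists f; split.
- move=> n; apply: measurable_sum => j; apply: measurable_funM => //.
  by apply: measurable_indic; exact: mE.
- move=> n x.
  have /andP[f0 f1] := tail n 0%N (fun j => \1_(E j n) x) (leq0n n) (fun j =>
    ind01 _ _ _).
  rewrite big_mkord in f0 f1; rewrite f0/= (le_trans f1)//.
  by rewrite expr0 invr1 gerBl invr_ge0 exprn_ge0.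
apply/loeb_aeP.
apply: (@loeb_null_sub _ _ _ _ _ _ (\bigcup_j [set w | ~ (X j w <-> internal U
  (E j) w)])); last first.
  by apply: loeb_null_bigcup => // j; have [] := XE j.
move=> w /= nf; apply: contrapT => ngood; apply: nf.
have good j : X j w <-> internal U (E j) w.
  by apply: contrapT => nj; apply: ngood; exists j.
apply: ulim_eq; apply/cvgrPdist_le => e e0.
have [k ke] : exists k, (2 ^+ k)^-1 <= e.
  exists (Num.truncn e^-1).+1.
  rewrite invf_ple ?posrE ?exprn_gt0// (le_trans (ltW (truncnS_gt _)))//.
  by rewrite -natrX ler_nat ltnW// ltn_expl.
have kU : \forall n \near U, (k <= n)%N by apply: Uoo; exists k.
have eqU : \forall n \near U, forall j : 'I_k,
  \1_(E j n) (w n) = \1_(X j) w :> R.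
  apply: filter_forall => j; have [Xw|Xw] := pselect (X j w).
    have := proj1 (good j) Xw; apply: filterS => n Ew.
    by rewrite !indicE !mem_set.
  have : (~` internal U (E j)) w by move/(proj2 (good j)).
  rewrite -internalC; apply: filterS => n Ew.
  by rewrite !indicE !memNset.
(* The first [k] digits now agree, and both the tail of [f n] and the remainder [r k] lie between 0
   and [2 ^- k]. *)
apply: filterS2 kU eqU => n kn eqn.
have -> : f n (w n) = \sum_(j < k) h j * \1_(X j) w + \sum_(k <= j < n) h j *
  \1_(E j n) (w n).
  rewrite /f -(big_mkord xpredT (fun j =>
    h j * \1_(E j n) (w n))) (big_cat_nat (n := k))//=.
  by rewrite big_mkord; congr (_ + _); apply: eq_bigr => j _; rewrite eqn.
rewrite (gE k w) opprD addrACA subrr add0r.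
have /andP[t0 t1] := tail n k (fun j => \1_(E j n) (w n)) kn (fun j =>
  ind01 _ _ _).
have /andP[r0 r1] := r01 k w.
have p0 : 0 <= (2 ^+ n)^-1 :> R by rewrite invr_ge0 exprn_ge0.
rewrite (le_trans _ ke)// ler_norml; apply/andP; split; lra.
Qed.

Lemma loeb_lift (v : L -> R) (M : R) : 0 < M -> measurable_fun setT v ->
  {ae LP, forall w, `|v w| <= M} -> exists f, is_lift M v f.
Proof.
move=> M0 mv vM.
(* Clipping to [[-M, M]] changes [v] on a null set only; the affine map then sends this interval to
   [[0, 1]]. *)
pose g w := (Num.max (- M) (Num.min (v w) M) + M) / (2 * M).
have mg : measurable_fun setT g.
  apply: measurable_funM => //; apply: measurable_funD => //.
  by apply: measurable_maxr => //; exact: measurable_minr.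
have M20 : 0 < 2 * M by rewrite mulr_gt0.
have [w|f [mf f01 fg]] := loeb_lift01 mg.
  have m1 : - M <= Num.max (- M) (Num.min (v w) M) by rewrite le_max lexx.
  have m2 : Num.max (- M) (Num.min (v w) M) <= M.
    by rewrite ge_max ge_min lexx orbT andbT; lra.
  by rewrite /g; apply/andP; split; [rewrite divr_ge0//|rewrite ler_pdivrMr//];
    lra.
exists (fun n x => 2 * M * f n x - M); split.
- by move=> n; apply: measurable_funB => //; exact: measurable_funM.
- move=> n x; have /andP[f0 f1] := f01 n x; rewrite ler_norml; apply/andP;
  split; nra.
have fb w : ubf f w.
  apply: (ubf_bounded (M := 1)) => n x; have /andP[f0 f1] := f01 n x.
  by rewrite ger0_norm.
apply: filterS2 vM fg => w vw fgw.
have bc (a : R) : ubounded U (fun=> a) by exact: (@ubounded_bnd _ _ _ _ `|a|).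
rewrite /ulf ulimD//; last by apply: uboundedM => //; exact: fb.
rewrite ulimM//; last exact: fb.
rewrite !ulim_cst -/(ulf f w) fgw /g.
move: vw; rewrite ler_norml => /andP[v1 v2].
rewrite (min_idPl v2) (max_idPr v1) mulrC divfK ?gt_eqF//.
by rewrite addrK.
Qed.

Lemma is_lift_cvg M v f : is_lift M v f ->
  {ae LP, forall w, (fun n => f n (w n)) @ U --> v w}.
Proof.
move=> [mf fM]; apply: filterS => w <-; apply: cvg_ulim.
exact: ubf_bounded fM w.
Qed.

Lemma is_lift_ulf (M : R) (f : forall n, T n ->
  R) : (forall n, measurable_fun setT (f n)) ->
  (forall n x, `|f n x| <= M) -> is_lift M (ulf f) f.
Proof. by move=> mf fM; split => //; exact: aeW. Qed.

Lemma is_lift_lin (a M N : R) v w f g : is_lift M v f -> is_lift N w g ->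
  is_lift (`|a| * M + N) (fun x => a * v x + w x) (fun n x =>
    a * f n x + g n x).
Proof.
move=> [mf fM fv] [mg gN gw]; split.
- by move=> n; apply: measurable_funD => //; exact: measurable_funM.
- by move=> n x; rewrite (le_trans (ler_normD _ _))// lerD// normrM ler_wpM2l.
have bc (b : R) : ubounded U (fun=> b) by exact: (@ubounded_bnd _ _ _ _ `|b|).
apply: filterS2 fv gw => x <- <-; have fb := ubf_bounded fM x.
have gb := ubf_bounded gN x.
by rewrite /ulf ulimD ?ulimM ?ulim_cst//; exact: uboundedM.
Qed.

End LoebLift.

(** * The limit operator *)

Section LoebOperator.
Context (R : realType) (U : set_system nat) (UF : UltraFilter U)
  (Uoo : \oo `<=` U)
  (d : nat -> measure_display) (T : forall n, measurableType (d n))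
  (P : forall n, probability (T n) R) (A : forall n, Poperator (P n)).
Context (c p : R) (q : \bar R).
Hypotheses (c0 : 0 < c) (p1 : 1 <= p) (q1 : (1%:E < q)%E)
  (Ac : forall n, (opnorm (P n) (A n) p%:E q <= c%:E)%E).

Local Notation L := (loeb UF Uoo P).
Local Notation LP := (loeb_prob UF Uoo P).
Local Notation ulf := (@ulf _ _ UF Uoo _ _ P).
Local Notation ubf := (@ubf _ _ UF Uoo _ _ P).

Local Notation is_lift := (@is_lift _ _ UF Uoo _ _ P).

Let p0 : 0 < p. Proof. exact: lt_le_trans p1. Qed.
Let q0 : (0 < q)%E. Proof. by apply: lt_trans q1; rewrite lte_fin. Qed.

Definition opf (f : forall n, T n -> R) : forall n, T n ->
  R := fun n => A n (f n).

Arguments opf f n x : clear implicits.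

Lemma opf_meas M v f : is_lift M v f -> forall n, measurable_fun setT (opf f n).
Proof. by move=> [mf fM _] n; apply: Pop_meas;
  exact: Linf_bnd (mf n) (fM n). Qed.

Lemma opf_ub M v f : is_lift M v f -> {ae LP, forall w, ubf (opf f) w}.
Proof.
move=> vf; have [mf fM _] := vf; have mAf := opf_meas vf.
have M0 : 0 <= M by rewrite (le_trans _ (fM 0%N point)).
(* [M + 1] replaces [M] because the operator bound is stated for positive norms, whereas [M] may be
   0. *)
apply: (loeb_markov UF Uoo (C := c * (M + 1)) mAf) => n.
apply: (Pop_bound1 c0 p1 q1 (Ac n)); first by rewrite ltr_pwDr.
  exact: Linf_bnd (mf n) (fM n).
apply: le_trans (Linf_Lnorm_bnd (P n) p1 (mf n) M0 (fM n)) _.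
by rewrite lee_fin lerDl.
Qed.

Lemma measurable_opf M v f : is_lift M v f -> measurable_fun setT (ulf (opf f)).
Proof. by move=> vf; apply: measurable_ulf;
  [exact: opf_meas vf|exact: opf_ub vf]. Qed.

(** The strict bound on [v] passes down to [f n] for [U]-many [n], the operator bound applies there,
    and Fatou's lemma passes the result back up. *)
Lemma opf_Lnorm M v f (K : R) : 0 < K -> is_lift M v f ->
  measurable_fun setT v ->
  (Lnorm LP p%:E (EFin \o v) < K%:E)%E ->
  (Lnorm LP q (EFin \o ulf (opf f)) <= (c * K)%:E)%E.
Proof.
move=> K0 vf mv vK; have [mf fM fv] := vf.
have mulf : measurable_fun setT (ulf f).
  by apply: measurable_ulf => //; apply: aeW; exact: ubf_bounded fM.
have {}vK : (Lnorm LP p%:E (EFin \o ulf f) < K%:E)%E.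
  by rewrite (@ae_eq_Lnorm _ _ _ _ _ v).
apply: loeb_Lnorm_fatou => //; first by rewrite mulr_ge0// ltW.
- exact: opf_meas vf.
- exact: opf_ub vf.
have := loeb_Lnorm_lt p0 (ltW K0) mf fM vK; apply: filterS => n.
apply: (Pop_bound c0 p1 q1 (Ac n)) => //.
exact: Linf_bnd (mf n) (fM n).
Qed.

(** The limit has [p]-norm 0, below [e / c] for every [e], so the image has [q]-norm at most [e]. An
    infinite exponent would break the descent to [f n]: indicators of sets of measure tending to 0
    keep essential supremum 1 although their ultralimit is null. *)
Lemma opf_eq0 M v f : is_lift M v f -> {ae LP, forall w, v w = 0} ->
  {ae LP, forall w, ulf (opf f) w = 0}.
Proof.
move=> vf v0; have [mf fM fv] := vf.
have vf0 : is_lift M (fun=> 0) f.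
  by split => //; apply: filterS2 fv v0 => w -> ->.
have N0 : Lnorm LP q (EFin \o ulf (opf f)) = 0%E.
  apply/eqP; rewrite eq_le Lnorm_ge0 andbT; apply/lee_addgt0Pr => e e0;
    rewrite add0e.
  have e'0 : 0 < e * c^-1 by rewrite mulr_gt0// invr_gt0.
  rewrite (_ : e = c * (e * c^-1)); last by rewrite mulrCA divff ?mulr1//
    gt_eqF.
  apply: (opf_Lnorm e'0 vf0) => //.
  by rewrite (_ : EFin \o _ = cst 0%E)// Lnorm0 ?lte_fin// eqe gt_eqF.
have := Lnorm_eq0_eq0 _ q0 N0 => H.
have : (EFin \o ulf (opf f) = \0 %[ae LP])%E.
  by apply: H; apply/measurable_EFinP; exact: measurable_opf vf.
by apply: filterS => w /(_ I) [].
Qed.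

Lemma opf_lin (a M N : R) v w f g : is_lift M v f -> is_lift N w g ->
  {ae LP, forall x, ulf (opf (fun n x => a * f n x + g n x)) x =
                    a * ulf (opf f) x + ulf (opf g) x}.
Proof.
move=> vf wg; have [mf fM _] := vf; have [mg gN _] := wg.
have := @loeb_ae_near _ _ UF Uoo _ _ P (fun n x => A n (fun y =>
  a * f n y + g n y) x = a * A n (f n) x + A n (g n) x).
have H n : {ae P n, forall x, A n (fun y =>
  a * f n y + g n y) x = a * A n (f n) x + A n (g n) x}.
  by apply: Pop_lin; [exact: Linf_bnd (mf n) (fM n)|exact: Linf_bnd (mg n) (gN
    n)].
move=> /(_ H) {}H.
have bc (b : R) : ubounded U (fun=> b) by exact: (@ubounded_bnd _ _ _ _ `|b|).
near=> x.
have fb : ubf (opf f) x by near: x; exact: opf_ub vf.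
have gb : ubf (opf g) x by near: x; exact: opf_ub wg.
have Hx : \forall n \near U, A n (fun y =>
  a * f n y + g n y) (x n) = a * A n (f n) (x n) + A n (g n) (x n).
  by near: x.
have -> : ulf (opf (fun n x => a * f n x + g n x)) x = ulim U (fun n =>
  a * opf f n (x n) + opf g n (x n)).
  apply: ulim_eq; apply: cvg_trans (cvg_ulim UF _); last first.
    by apply: uboundedD => //; exact: uboundedM.
  by apply: near_eq_cvg; apply: filterS Hx => n.
by rewrite ulimD ?ulimM ?ulim_cst//; exact: uboundedM.
Unshelve. all: by end_near. Qed.

(** Two lifts of the same function are compared through the lift [-1 * f + g] of a null function.
    This is what makes the choice in [some_lift] harmless. *)
Lemma opf_eq M N v w f g : is_lift M v f -> is_lift N w g ->
  {ae LP, forall x, v x = w x} ->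
  {ae LP, forall x, ulf (opf f) x = ulf (opf g) x}.
Proof.
move=> vf wg vw.
have := opf_lin (-1) vf wg.
have /opf_eq0 : is_lift (`|-1| * M + N) (fun x => -1 * v x + w x) (fun n x =>
  -1 * f n x + g n x).
  exact: is_lift_lin.
have vw0 : {ae LP, forall x, -1 * v x + w x = 0}.
  by apply: filterS vw => x ->; rewrite mulN1r addNr.
move=> /(_ vw0); apply: filterS2 => x -> /esym/eqP.
by rewrite mulN1r addrC subr_eq0 => /eqP.
Qed.

Definition some_lift (v : L -> R) : forall n, T n -> R :=
  xget (fun n x => 0) [set f | exists M, is_lift M v f].

Lemma some_liftP v : Linf_fun LP v -> exists M, is_lift M v (some_lift v).
Proof.
move=> [mv [M vM]]; rewrite /some_lift; case: xgetP => [f -> //|H].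
exfalso; have [||f vf] := @loeb_lift _ _ UF Uoo _ _ P v (`|M| + 1) _ mv.
- by rewrite ltr_pwDr.
- apply: filterS vM => w /le_trans; apply.
  by rewrite (le_trans (ler_norm _))// lerDl.
by apply: (H f); exists (`|M| + 1).
Qed.

Definition loeb_op (v : L -> R) : L -> R := ulf (opf (some_lift v)).

Lemma loeb_opE M v f : Linf_fun LP v -> is_lift M v f ->
  {ae LP, forall x, loeb_op v x = ulf (opf f) x}.
Proof.
move=> /some_liftP[N vN] vf; apply: (opf_eq vN vf); exact: aeW.
Qed.

Lemma loeb_op_meas v : Linf_fun LP v -> measurable_fun setT (loeb_op v).
Proof. by move=> /some_liftP[M vM]; exact: measurable_opf vM. Qed.

Lemma loeb_op_Lnorm v (K : R) : Linf_fun LP v -> 0 < K ->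
  (Lnorm LP p%:E (EFin \o v) < K%:E)%E ->
  (Lnorm LP q (EFin \o loeb_op v) <= (c * K)%:E)%E.
Proof.
move=> Lv K0; have [M vM] := some_liftP Lv; apply: opf_Lnorm vM _ => //.
by case: Lv.
Qed.

Lemma loeb_op_Lnorm_le v : Linf_fun LP v ->
  (Lnorm LP q (EFin \o loeb_op v) <= c%:E * Lnorm LP p%:E (EFin \o v))%E.
Proof.
move=> Lv; have := Linf_Lnorm_fin p1 Lv; have := Lnorm_ge0 LP p%:E (EFin \o v).
have := @loeb_op_Lnorm v ^~ Lv.
case: (Lnorm LP p%:E (EFin \o v)) => [x| |]// H; rewrite lee_fin => x0 _.
apply/lee_addgt0Pr => e e0; rewrite -EFinM -EFinD.
have -> : c * x + e = c * (x + e / c) by rewrite mulrDr mulrCA divff ?mulr1//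
  gt_eqF.
have ec : 0 < e / c by rewrite divr_gt0.
by apply: H; rewrite ?lte_fin ?ltr_pwDr ?ltrDl.
Qed.

Lemma loeb_op_int v : Linf_fun LP v -> LP.-integrable setT (EFin \o loeb_op v).
Proof.
move=> Lv; have mv := loeb_op_meas Lv.
apply/integrableP; split; first exact/measurable_EFinP.
rewrite -[X in (X < _)%E](Lnorm1 LP (EFin \o loeb_op v)).
apply: (le_lt_trans (Lnorm1_le LP q1 mv)).
apply: (le_lt_trans (loeb_op_Lnorm_le Lv)).
by rewrite -(fineK (Linf_Lnorm_fin p1 Lv)) -EFinM ltry.
Qed.

Lemma loeb_op_ae v w : Linf_fun LP v -> Linf_fun LP w ->
  {ae LP, forall x, v x = w x} -> {ae LP, forall x, loeb_op v x = loeb_op w x}.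
Proof. by move=> /some_liftP[M vM] /some_liftP[N wN]; exact: opf_eq vM wN. Qed.

Lemma loeb_op_lin (a : R) v w : Linf_fun LP v -> Linf_fun LP w ->
  {ae LP, forall x, loeb_op (fun y => a * v y + w y) x =
                    a * loeb_op v x + loeb_op w x}.
Proof.
move=> Lv Lw; have [M vM] := some_liftP Lv; have [N wN] := some_liftP Lw.
have := loeb_opE (Linf_lin a Lv Lw) (is_lift_lin a vM wN).
by apply: filterS2 (opf_lin a vM wN) => x <-.
Qed.

Lemma loeb_op_opnorm : (opnorm LP loeb_op p%:E q <= c%:E)%E.
Proof.
apply: ge_ereal_sup => _ [v [Lv v0] <-].
have vfin := Linf_Lnorm_fin p1 Lv.
have x0 : 0 < fine (Lnorm LP p%:E (EFin \o v)).
  by rewrite -lte_fin fineK// lt_neqAle eq_sym v0 Lnorm_ge0.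
by rewrite lee_pdivrMr// fineK// loeb_op_Lnorm_le.
Qed.

(** On a probability space the 1-norm is at most the [q]-norm and the [p]-norm at most the essential
    supremum, so [c] bounds this norm as well. *)
Lemma loeb_op_bdd : (opnorm LP loeb_op +oo%E 1%:E < +oo)%E.
Proof.
apply: (@le_lt_trans _ _ c%:E); last exact: ltry.
apply: ge_ereal_sup => _ [v [Lv v0] <-].
have [mv [M vM]] := Lv.
have vfin : Lnorm LP +oo%E (EFin \o v) \is a fin_num.
  rewrite ge0_fin_numE ?Lnorm_ge0//; apply: (@le_lt_trans _ _ M%:E);
    last exact: ltry.
  by apply/Lnormy_leP; apply: filterS vM => w; rewrite lee_fin.
have x0 : 0 < fine (Lnorm LP +oo%E (EFin \o v)).
  by rewrite -lte_fin fineK// lt_neqAle eq_sym v0 Lnorm_ge0.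
rewrite lee_pdivrMr// fineK//.
apply: (le_trans (Lnorm1_le LP q1 (loeb_op_meas Lv))).
apply: (le_trans (loeb_op_Lnorm_le Lv)).
by rewrite lee_pmul2l ?lte_fin//; exact: Lnorm_ley.
Qed.

Definition loeb_Pop : Poperator LP :=
  Build_Poperator loeb_op_meas loeb_op_int loeb_op_ae loeb_op_lin loeb_op_bdd.

End LoebOperator.

Arguments opf {R d T P} A f n x.

(** * The Levy-Prokhorov distance *)

Section Euclid.
Context (R : realType) (m : nat).
Implicit Types (x y z : 'rV[R]_m) (B : set 'rV[R]_m).

Lemma cauchy_schwarz_sum (a b : 'I_m -> R) :
  (\sum_i a i * b i) ^+ 2 <= (\sum_i a i ^+ 2) * (\sum_i b i ^+ 2).
Proof.
set D := \sum_i a i * b i; set Sa := \sum_i a i ^+ 2; set Sb := \sum_i b i ^+ 2.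
have expand t s : \sum_i (t * a i + s * b i) ^+ 2 = t ^+ 2 * Sa + 2 * t * s * D
  + s ^+ 2 * Sb.
  rewrite /Sa /Sb /D !mulr_sumr -!big_split/=; apply: eq_bigr => i _; ring.
have Sb0 : 0 <= Sb by apply: sumr_ge0 => i _; exact: sqr_ge0.
have [Sb1|Sb1] := eqVneq Sb 0.
  have b0 i : b i = 0.
    apply/eqP; rewrite -sqrf_eq0; apply/eqP; move: i (erefl true).
    by apply/psumr_eq0P => // i _; exact: sqr_ge0.
  by rewrite /D big1 ?expr0n ?Sb1 ?mulr0//= => i _; rewrite b0 mulr0.
(* These coefficients minimise the quadratic form up to scaling, and its value there is [Sb] times
   the gap in the inequality. *)
have : 0 <= \sum_i (Sb * a i + (- D) * b i) ^+ 2.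
  by apply: sumr_ge0 => i _; exact: sqr_ge0.
rewrite expand.
have -> : Sb ^+ 2 * Sa + 2 * Sb * - D * D + (- D) ^+ 2 * Sb = Sb * (Sa * Sb - D
  ^+ 2) by ring.
by rewrite pmulr_rge0 ?subr_ge0// lt_neqAle eq_sym Sb1.
Qed.

Lemma eucl_sym x y : eucl x y = eucl y x.
Proof.
by rewrite /eucl; congr Num.sqrt; apply: eq_bigr => i _; rewrite -opprB sqrrN.
Qed.

Lemma eucl_triangle x y z : eucl x z <= eucl x y + eucl y z.
Proof.
rewrite /eucl; pose a i := x ord0 i - y ord0 i; pose b i := y ord0 i - z ord0 i.
rewrite -[X in _ <= X + _]/(Num.sqrt (\sum_i a i ^+ 2)).
rewrite -[X in _ <= _ + X]/(Num.sqrt (\sum_i b i ^+ 2)).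
have -> : \sum_i (x ord0 i - z ord0 i) ^+ 2 =
    \sum_i a i ^+ 2 + 2 * (\sum_i a i * b i) + \sum_i b i ^+ 2.
  rewrite !mulr_sumr -!big_split/=; apply: eq_bigr => i _; rewrite /a /b; ring.
have Sa0 : 0 <= \sum_i a i ^+ 2 by apply: sumr_ge0 => i _; exact: sqr_ge0.
have Sb0 : 0 <= \sum_i b i ^+ 2 by apply: sumr_ge0 => i _; exact: sqr_ge0.
have D : \sum_i a i * b i <= Num.sqrt (\sum_i a i ^+ 2) * Num.sqrt (\sum_i b i
  ^+ 2).
  rewrite -sqrtrM// (le_trans (ler_norm _))// -sqrtr_sqr ler_wsqrtr//.
  exact: cauchy_schwarz_sum.
rewrite -[leRHS]ger0_norm ?addr_ge0 ?sqrtr_ge0// -sqrtr_sqr ler_wsqrtr//.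
rewrite sqrrD !sqr_sqrtr// lerD2r lerD2l mulr_natl -mulr_natl.
by rewrite -[leRHS]mulr_natl ler_pM2l.
Qed.

Lemma eucl_le x y (e : R) : 0 <= e -> (forall i, `|x ord0 i - y ord0 i| <= e) ->
  eucl x y <= m%:R * e.
Proof.
move=> e0 xye; rewrite -[leRHS]ger0_norm ?mulr_ge0// -sqrtr_sqr ler_wsqrtr//.
apply: (@le_trans _ _ (\sum_(i < m) e ^+ 2)).
  by apply: ler_sum => i _; rewrite -real_normK ?num_real// ler_sqr ?nnegrE.
rewrite sumr_const card_ord -[leLHS]mulr_natl exprMn; apply: ler_wpM2r;
  first exact: sqr_ge0.
by rewrite expr2; case: (m) => [|k]; rewrite ?mulr0// ler_peMr// ler1n.
Qed.

Definition eball x (e : R) : set 'rV[R]_m := [set y | eucl x y < e].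

Lemma eopen_eball x e : eopen (eball x e).
Proof.
move=> y xy; exists (e - eucl x y); first by rewrite subr_gt0.
by move=> z yz; rewrite /eball/= (le_lt_trans (eucl_triangle x y z))// -ltrBrDl.
Qed.

Lemma eopen_nbhd e B : eopen (nbhd_set e B).
Proof.
move=> x [y By xy]; exists (e - eucl x y); first by rewrite subr_gt0.
move=> z xz; exists y => //; rewrite (le_lt_trans (eucl_triangle z x y))//.
by rewrite eucl_sym -ltrBrDr.
Qed.

Lemma borel_eopen B : eopen B -> borel B.
Proof. by move=> oB; apply: sub_gen_smallest. Qed.

Lemma borel_nbhd e B : borel (nbhd_set e B).
Proof. by apply: borel_eopen; exact: eopen_nbhd. Qed.

Lemma nbhd_set_le e e' B : e <= e' -> nbhd_set e B `<=` nbhd_set e' B.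
Proof. by move=> ee x [y By xy]; exists y => //; exact: lt_le_trans ee. Qed.

Lemma nbhd_setD e e' B : nbhd_set e (nbhd_set e' B) `<=` nbhd_set (e + e') B.
Proof.
move=> x [y [z Bz yz] xy]; exists z => //.
by rewrite (le_lt_trans (eucl_triangle x y z))// ltrD.
Qed.

Definition ratpt (j : nat) : 'rV[R]_m :=
  if @unpickle 'rV[rat]_m j is Some q then map_mx ratr q else 0.

Lemma ratpt_dense x (e : R) : 0 < e -> exists j, eucl (ratpt j) x < e.
Proof.
move=> e0; pose h := e / m.+1%:R.
have h0 : 0 < h by rewrite divr_gt0.
have /choice[q qP] i : exists q : rat, `|ratr q - x ord0 i| <= h.
  have [|q] := @rat_in_itvoo R (x ord0 i - h) (x ord0 i + h); first by lra.
  rewrite in_itv/= => /andP[q1 q2]; exists q.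
  by rewrite ler_norml; apply/andP; split; lra.
exists (pickle (\row_i q i : 'rV[rat]_m)).
apply: le_lt_trans (_ : m%:R * h < e).
  apply: eucl_le => [|i]; first exact: ltW.
  by rewrite /ratpt pickleK !mxE.
by rewrite /h mulrCA gtr_pMr// ltr_pdivrMr// mul1r ltr_nat.
Qed.

(** Countably many balls with rational centres generate the open sets. Hence coordinatewise
    measurability, which controls preimages of balls, controls preimages of all Borel sets. *)
Lemma eopen_bigcup_eball B : eopen B ->
  B = \bigcup_(jk in [set jk : nat * nat |
         eball (ratpt jk.1) jk.2.+1%:R^-1 `<=` B])
        eball (ratpt jk.1) jk.2.+1%:R^-1.
Proof.
move=> oB; apply/seteqP; split => [x Bx|x [jk jkB] /jkB//].
have [e e0 xe] := oB _ Bx.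
pose k := Num.truncn (2 / e).
have ke : k.+1%:R^-1 < e / 2 by rewrite invf_plt ?posrE ?divr_gt0// invf_div
  truncnS_gt.
have [j jx] : exists j, eucl (ratpt j) x < k.+1%:R^-1 by apply: ratpt_dense;
  rewrite invr_gt0.
exists (j, k) => //= y jy; apply: xe.
rewrite (le_lt_trans (eucl_triangle x (ratpt j) y))// eucl_sym.
by rewrite (splitr e) ltrD// (lt_trans _ ke).
Qed.

End Euclid.

(** * Measurability of random vectors *)

Section RandomVectors.
Context (R : realType) (m : nat) d (T : measurableType d) (P : probability T R).

Definition rvec (X : T -> 'rV[R]_m) :=
  forall i, measurable_fun setT (fun t => X t ord0 i).

Variables (X : T -> 'rV[R]_m) (mX : rvec X).

Lemma measurable_eucl (a : 'rV[R]_m) : measurable_fun setT (fun t =>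
  eucl a (X t)).
Proof.
apply: (@measurableT_comp _ _ _ _ _ _ (@Num.sqrt R)).
  by apply: continuous_measurable_fun; exact: sqrt_continuous.
apply: measurable_sum => i; apply: measurable_funX; exact: measurable_funB.
Qed.

Lemma rvec_eball a e : measurable (X @^-1` eball a e).
Proof. by apply: measurable_lt; exact: measurable_eucl. Qed.

Lemma rvec_eopen B : eopen B -> measurable (X @^-1` B).
Proof.
move=> /eopen_bigcup_eball ->; rewrite preimage_bigcup bigcup_mkcond.
pose F (jk : nat * nat) := if jk \in [set jk : nat * nat |
         eball (@ratpt R m jk.1) jk.2.+1%:R^-1 `<=` B]
     then X @^-1` eball (ratpt R m jk.1) jk.2.+1%:R^-1 else set0.
rewrite (_ : \bigcup_i _ = \bigcup_j \bigcup_k F (j, k)).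
  apply: bigcupT_measurable => j; apply: bigcupT_measurable => k.
  by rewrite /F; case: ifPn => // _; exact: rvec_eball.
apply/seteqP; split => t; first by move=> [[j k] _ h]; exists j => //; exists k.
by move=> [j _ [k _ h]]; exists (j, k).
Qed.

Lemma rvec_borel B : borel B -> measurable (X @^-1` B).
Proof.
move: B; apply: (@smallest_sub _ (sigma_algebra setT) _ [set B | measurable (X
  @^-1` B)]).
  split => /=.
  - by rewrite preimage_set0.
  - by move=> B mB; rewrite setTD preimage_setC; exact: measurableC.
  - by move=> F mF; rewrite preimage_bigcup; exact: bigcupT_measurable.
by move=> B; exact: rvec_eopen.
Qed.

Lemma jdistr_le B C : borel B -> borel C -> B `<=` C ->
  (jdistr P X B <= jdistr P X C)%E.
Proof.
by move=> bB bC BC; apply: le_measure; rewrite ?inE;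
  [exact: rvec_borel..|exact: preimage_subset].
Qed.

Lemma jdistr_le1 B : borel B -> (jdistr P X B <= 1)%E.
Proof. by move=> bB; rewrite probability_le1//; exact: rvec_borel. Qed.

End RandomVectors.

(** * Closeness of measures and the triangle inequality *)

Section LevyProkhorov.
Context (R : realType) (m : nat).
Implicit Types mu nu rho : meas_Rm R m.

Definition lpclose (e : R) mu nu := forall B, borel B ->
  (mu B <= nu (nbhd_set e B) + e%:E)%E /\ (nu B <= mu (nbhd_set e B) + e%:E)%E.

Lemma dLP_lb mu nu : has_lbound [set e : R | 0 < e /\ lpclose e mu nu].
Proof. by exists 0 => e [/ltW]. Qed.

Lemma dLP_le e mu nu : 0 < e -> lpclose e mu nu -> dLP mu nu <= e.
Proof. by move=> e0 h; apply: ge_inf; [exact: dLP_lb|split]. Qed.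

Lemma dLP_ge0 mu nu : 0 <= dLP mu nu.
Proof.
have [E0|/set0P E0] := eqVneq [set e : R | 0 < e /\ lpclose e mu nu] set0.
  by rewrite /dLP [X in inf X]E0 inf0.
by apply: lb_le_inf => // e [/ltW].
Qed.

Lemma dLP_sym mu nu : dLP mu nu = dLP nu mu.
Proof.
rewrite /dLP; congr inf; apply/seteqP.
by split=> e [e0 h]; split => // B /h[].
Qed.

End LevyProkhorov.

Section LevyProkhorovDistr.
Context (R : realType) (m : nat).
Context d1 (T1 : measurableType d1) (P1 : probability T1 R) (X1 : T1 ->
  'rV[R]_m).
Context d2 (T2 : measurableType d2) (P2 : probability T2 R) (X2 : T2 ->
  'rV[R]_m).
Hypotheses (mX1 : rvec X1) (mX2 : rvec X2).

(** Radius 1 always works for probabilities, so the infimum defining [dLP] is over a nonempty set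
    and is not the default 0. *)
Lemma lpclose1 : lpclose 1 (jdistr P1 X1) (jdistr P2 X2).
Proof.
by move=> B bB; split; (apply: le_trans (jdistr_le1 _ _ bB) _ => //;
  rewrite leeDr// measure_ge0).
Qed.

Lemma dLP_le1 : dLP (jdistr P1 X1) (jdistr P2 X2) <= 1.
Proof. by apply: dLP_le => //; exact: lpclose1. Qed.

Lemma dLP_lt e : dLP (jdistr P1 X1) (jdistr P2 X2) < e ->
  lpclose e (jdistr P1 X1) (jdistr P2 X2).
Proof.
move=> /inf_lt[|e' [e'0 h] /ltW ee B bB].
  by exists 1; split => //; exact: lpclose1.
have [h1 h2] := h B bB; split.
  apply: (le_trans h1); apply: leeD; last by rewrite lee_fin.
  by apply: jdistr_le => //; [exact: borel_nbhd..|exact: nbhd_set_le].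
apply: (le_trans h2); apply: leeD; last by rewrite lee_fin.
by apply: jdistr_le => //; [exact: borel_nbhd..|exact: nbhd_set_le].
Qed.

End LevyProkhorovDistr.

(** Strict premises spare the question whether the infimum is attained. The statement is about
    distributions, since [dLP] accepts arbitrary set functions and enlarging the radius uses
    monotonicity on Borel sets. *)
Lemma dLP_triangle_lt (R : realType) (m : nat)
    d1 (T1 : measurableType d1) (P1 : probability T1 R) (X1 : T1 -> 'rV[R]_m)
    d2 (T2 : measurableType d2) (P2 : probability T2 R) (X2 : T2 -> 'rV[R]_m)
    d3 (T3 : measurableType d3) (P3 : probability T3 R) (X3 : T3 -> 'rV[R]_m)
    (e1 e2 : R) : rvec X1 -> rvec X2 -> rvec X3 ->
  dLP (jdistr P1 X1) (jdistr P2 X2) < e1 ->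
    dLP (jdistr P2 X2) (jdistr P3 X3) < e2 ->
  dLP (jdistr P1 X1) (jdistr P3 X3) <= e1 + e2.
Proof.
move=> m1 m2 m3 h1 h2.
apply: dLP_le; first by rewrite addr_gt0 ?(le_lt_trans (dLP_ge0 _ _) h1)
  ?(le_lt_trans (dLP_ge0 _ _) h2).
have {}h1 := dLP_lt m1 m2 h1; have {}h2 := dLP_lt m2 m3 h2.
move=> B bB; split.
  have [+ _] := h1 B bB; move/le_trans; apply.
  rewrite EFinD addeA [X in (_ <= X)%E]addeAC leeD2r//.
  have [+ _] := h2 _ (borel_nbhd e1 B); move/le_trans; apply; rewrite leeD2r//.
  apply: jdistr_le => //; [exact: borel_nbhd..|].
  by rewrite addrC; exact: nbhd_setD.
have [_ +] := h2 B bB; move/le_trans; apply.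
rewrite EFinD addeA leeD2r//.
have [_ +] := h1 _ (borel_nbhd e2 B); move/le_trans; apply; rewrite leeD2r//.
apply: jdistr_le => //; [exact: borel_nbhd..|].
exact: nbhd_setD.
Qed.

(** * Weak limits of random vectors *)

Section LoebWeakLimit.
Context (R : realType) (U : set_system nat) (UF : UltraFilter U)
  (Uoo : \oo `<=` U)
  (d : nat -> measure_display) (T : forall n, measurableType (d n))
  (P : forall n, probability (T n) R).

Local Notation L := (loeb UF Uoo P).
Local Notation LP := (loeb_prob UF Uoo P).

Variables (m : nat) (X : forall n, T n -> 'rV[R]_m) (Y : L -> 'rV[R]_m).
Arguments X n _ : clear implicits.
Hypotheses (mX : forall n, rvec (X n)) (mY : rvec Y)
  (XY : {ae LP, forall w, forall i,
    (fun n => X n (w n) ord0 i) @ U --> Y w ord0 i}).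

Lemma eucl_cvg (x : nat -> 'rV[R]_m) (y : 'rV[R]_m) (e : R) : 0 < e ->
  (forall i, (fun n => x n ord0 i) @ U --> y ord0 i) ->
  \forall n \near U, eucl (x n) y < e.
Proof.
move=> e0 xy; pose h := e / m.+1%:R.
have h0 : 0 < h by rewrite divr_gt0.
have : \forall n \near U, forall i : 'I_m, `|x n ord0 i - y ord0 i| <= h.
  apply: filter_forall => i; have /cvgrPdist_le/(_ h h0) := xy i.
  by apply: filterS => n; rewrite distrC.
apply: filterS => n xyn; apply: le_lt_trans (_ : m%:R * h < e).
  by apply: eucl_le => //; exact: ltW.
by rewrite /h mulrCA gtr_pMr// ltr_pdivrMr// mul1r ltr_nat.
Qed.

Let prX n (B : set 'rV[R]_m) := fine (jdistr (P n) (X n) B).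
Let prY (B : set 'rV[R]_m) := fine (jdistr LP Y B).

(** An open set containing [Y w] contains a ball around it, hence [X n (w n)] for [U]-many [n]: the
    event for [Y] lies in the internal event, up to a null set. *)
Lemma loeb_open_le (B : set 'rV[R]_m) (h : R) : 0 < h -> eopen B ->
  \forall n \near U, prY B <= prX n B + h.
Proof.
move=> h0 oB; have bB := borel_eopen oB.
pose E : iset T := fun n => X n @^-1` B.
have mE : imeas E by move=> n; exact: rvec_borel.
have YE : prY B <= imu U P E.
  rewrite /prY -lee_fin -(loeb_prob_internal UF Uoo P mE) fineK; last first.
    by rewrite fin_num_measure//; exact: rvec_borel.
  have /loeb_aeP nN := XY.
  have mN := loeb_null_measurable nN.
  apply: (@le_trans _ _ (LP (internal U E `|` [set w | ~ forall i,
      (fun n => X n (w n) ord0 i) @ U --> Y w ord0 i]))).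
    apply: le_measure; rewrite ?inE.
    - exact: rvec_borel.
    - by apply: measurableU => //; exact: internal_measurable.
    move=> w /= Bw; have [Hw|] := pselect (forall i,
      (fun n => X n (w n) ord0 i) @ U --> Y w ord0 i); last by right.
    left; have [e e0 Be] := oB _ Bw.
    have := eucl_cvg e0 Hw; apply: filterS => n; rewrite eucl_sym; exact: Be.
  apply: le_trans (measureU2 _ _ _) _ => //; first exact: internal_measurable.
  by rewrite -[leRHS]adde0 -(loeb_null_prob nN).
have : \forall n \near U, imu U P E - h < fine (P n (E n)).
  by apply: ulim_gt; [exact: ubounded_prob|rewrite ltrBlDr ltrDl].
apply: filterS => n /ltW; rewrite lerBlDr; exact: le_trans.
Qed.

(** If [X n (w n)] lies in [B] for [U]-many [n], one of these points is within [h] of [Y w]; the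
    internal event thus lies in the event that [Y] is in the neighbourhood. *)
Lemma loeb_borel_le (B : set 'rV[R]_m) (h : R) : 0 < h -> borel B ->
  \forall n \near U, prX n B <= prY (nbhd_set h B) + h.
Proof.
move=> h0 bB.
pose E : iset T := fun n => X n @^-1` B.
have mE : imeas E by move=> n; exact: rvec_borel.
have bN := borel_nbhd h B.
have YE : imu U P E <= prY (nbhd_set h B).
  rewrite /prY -lee_fin -(loeb_prob_internal UF Uoo P mE) fineK; last first.
    by rewrite fin_num_measure//; exact: rvec_borel.
  have /loeb_aeP nN := XY.
  have mN := loeb_null_measurable nN.
  apply: (@le_trans _ _ (LP (Y @^-1` (nbhd_set h B) `|` [set w | ~ forall i,
      (fun n => X n (w n) ord0 i) @ U --> Y w ord0 i]))).
    apply: le_measure; rewrite ?inE.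
    - exact: internal_measurable.
    - by apply: measurableU => //; exact: rvec_borel.
    move=> w /= Ew; have [Hw|] := pselect (forall i,
      (fun n => X n (w n) ord0 i) @ U --> Y w ord0 i); last by right.
    left; have [n [En XYn]] := @filter_ex _ U _ _ (filterI Ew (eucl_cvg h0 Hw)).
    by exists (X n (w n)) => //; rewrite eucl_sym.
  apply: le_trans (measureU2 _ _ _) _ => //; first exact: rvec_borel.
  by rewrite -[leRHS]adde0 -(loeb_null_prob nN).
have : \forall n \near U, fine (P n (E n)) < imu U P E + h.
  by apply: ulim_lt; [exact: ubounded_prob|rewrite ltrDl].
by apply: filterS => n /ltW /le_trans; apply; rewrite lerD2r.
Qed.

Let ballU h N (J : {set 'I_N}) : set 'rV[R]_m :=
  [set y | exists2 j : 'I_N, j \in J & eball (ratpt R m j) h y].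

Let eopen_ballU h N (J : {set 'I_N}) : eopen (ballU h J).
Proof.
move=> y [j jJ jy]; have [e e0 ye] := eopen_eball jy.
by exists e => // z yz; exists j => //; exact: ye.
Qed.

Let fineD2 (a b : \bar R) : a \is a fin_num -> b \is a fin_num ->
  (a <= b)%E = (fine a <= fine b).
Proof. by case: a; case: b. Qed.

(* Up to a small probability, Y takes its values in the union of finitely many
   small balls; a Borel set is then compared with the balls that meet it, and
   only finitely many such unions occur. *)
Lemma loeb_dLP (e : R) : 0 < e ->
  \forall n \near U, dLP (jdistr (P n) (X n)) (jdistr LP Y) <= e.
Proof.
(* The radii and the errors in measure each add up to at most [3 * h], so a quarter of [e] leaves
   room. *)
move=> e0; pose h := e / 4; have h0 : 0 < h by rewrite divr_gt0.
have hE : e = 4 * h by rewrite /h; lra.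
clearbody h.
have [N NY] : exists N, 1 - h < prY (ballU h [set: 'I_N]%SET).
  have mF N : measurable (Y @^-1` ballU h [set: 'I_N]%SET).
    by apply: rvec_borel => //; apply: borel_eopen; exact: eopen_ballU.
  have UT : \bigcup_N (Y @^-1` ballU h [set: 'I_N]%SET) = setT.
    apply/seteqP; split=> // w _; have [j jY] := ratpt_dense (Y w) h0.
    by exists j.+1 => //; exists ord_max; rewrite ?inE.
  have cv : LP (Y @^-1` ballU h [set: 'I_N]%SET) @[N --> \oo] --> LP setT.
    rewrite -UT; apply: nondecreasing_cvg_mu => //.
      by rewrite UT.
    move=> N M NM; apply/subsetPset => w [j _ jY].
    by exists (widen_ord NM j); rewrite ?inE.
  rewrite [X in _ --> X](@probability_setT _ _ _ LP) in cv.
  have lt1 : 1 - h < 1 by rewrite gtrBl.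
  by have [N NY] := @filter_ex _ \oo _ _ (cvgr_gt _ (fine_cvg cv) _ lt1);
    exists N.
have close1 : \forall n \near U, forall J : {set 'I_N},
    prY (ballU h J) <= prX n (ballU h J) + h.
  by apply: filter_forall => J; apply: loeb_open_le => //; exact: eopen_ballU.
have close2 : \forall n \near U, forall J : {set 'I_N},
    prX n (ballU h J) <= prY (nbhd_set h (ballU h J)) + h.
  apply: filter_forall => J; apply: loeb_borel_le => //.
  by apply: borel_eopen; exact: eopen_ballU.
apply: filterS2 close1 close2 => n close1 close2.
apply: dLP_le => // B bB.
pose J : {set 'I_N} := [set j : 'I_N | `[< (eball (ratpt R m j) h `&` B) !=set0
  >]]%SET.
have bJ (K : {set 'I_N}) : borel (ballU h K) by apply: borel_eopen;
  exact: eopen_ballU.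
have JB : ballU h J `<=` nbhd_set (h + h) B.
  move=> y [j]; rewrite inE => /asboolP[z [jz Bz]] jy; exists z => //.
  rewrite (le_lt_trans (eucl_triangle y (ratpt R m j) z))// ltrD//.
  by rewrite eucl_sym.
have BJ : B `<=` ballU h J `|` ~` ballU h [set: 'I_N]%SET.
  move=> y By; have [[j _ jy]|] := pselect (ballU h [set: 'I_N]%SET y);
    last by right.
  by left; exists j => //; rewrite inE; apply/asboolP; exists y.
have boundP d' (T' : measurableType d') (Q : probability T' R) (Z : T' ->
  'rV[R]_m) :
    rvec Z -> fine (jdistr Q Z B) <= fine (jdistr Q Z (ballU h J)) +
      (1 - fine (jdistr Q Z (ballU h [set: 'I_N]%SET))).
  move=> mZ.
  have mJ := rvec_borel mZ (bJ J); have mT :=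
    rvec_borel mZ (bJ [set: 'I_N]%SET).
  have mB := rvec_borel mZ bB.
  rewrite -lee_fin EFinD EFinB !fineK ?fin_num_measure//.
  rewrite -(probability_setC Q mT).
  apply: le_trans (measureU2 _ _ _) => //; last exact: measurableC.
  apply: le_measure; rewrite ?inE//; first by apply: measurableU => //;
    exact: measurableC.
  by move=> t /BJ[]; [left|right].
have boundX : prX n B <= prX n (ballU h J) + (1 - prX n (ballU h [set:
  'I_N]%SET)).
  exact: boundP.
have boundY : prY B <= prY (ballU h J) + (1 - prY (ballU h [set: 'I_N]%SET)).
  exact: boundP.
have bN := borel_nbhd e B.
have finX C : borel C -> jdistr (P n) (X n) C \is a fin_num.
  by move=> bC; rewrite fin_num_measure//; exact: rvec_borel.
have finY C : borel C -> jdistr LP Y C \is a fin_num.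
  by move=> bC; rewrite fin_num_measure//; exact: rvec_borel.
have leX C D : borel C -> borel D -> C `<=` D -> prX n C <= prX n D.
  by move=> bC bD CD; rewrite /prX -fineD2 ?finX//; exact: jdistr_le.
have leY C D : borel C -> borel D -> C `<=` D -> prY C <= prY D.
  by move=> bC bD CD; rewrite /prY -fineD2 ?finY//; exact: jdistr_le.
have c1 := close1 J; have c1T := close1 [set: 'I_N]%SET; have c2 := close2 J.
have l1 : prY (nbhd_set h (ballU h J)) <= prY (nbhd_set e B).
  apply: leY => //; first exact: borel_nbhd.
  move=> y [z /JB[t Bt zt] yz]; exists t => //.
  rewrite (le_lt_trans (eucl_triangle y z t))//; move: yz zt; lra.
have l2 : prX n (ballU h J) <= prX n (nbhd_set e B).
  apply: leX => //; move=> y /JB; apply: nbhd_set_le; lra.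
have arith1 (xB xJ xG yG yJh yE : R) : 1 - h < yG -> yG <= xG + h ->
  xJ <= yJh + h -> yJh <= yE -> xB <= xJ + (1 - xG) -> xB <= yE + e by lra.
have arith2 (yB yJ yG xJ xE : R) : 1 - h < yG -> yJ <= xJ + h -> xJ <= xE ->
  yB <= yJ + (1 - yG) -> yB <= xE + e by lra.
split; rewrite fineD2 ?fin_numD ?finX ?finY// fineD ?finX ?finY//=.
  exact: arith1 NY c1T c2 l1 boundX.
exact: arith2 NY c1 l2 boundY.
Qed.

End LoebWeakLimit.

(** * Atomless spaces *)

Section Atomless.
Context (R : realType) d (T : measurableType d) (P : probability T R).
Hypothesis aP : atomless P.

Let pr (A : set T) : R := fine (P A).

Let prE (A : set T) : measurable A -> P A = (pr A)%:E.
Proof. by move=> mA; rewrite fineK// fin_num_measure. Qed.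

Let pr_gt0 (A : set T) : measurable A -> (0 < P A)%E = (0 < pr A).
Proof. by move=> mA; rewrite prE. Qed.

Let pr_le (A B : set T) : measurable A -> measurable B -> A `<=` B ->
  pr A <= pr B.
Proof. by move=> mA mB AB; rewrite -lee_fin -!prE// le_measure// inE. Qed.

Let prU (A B : set T) : measurable A -> measurable B ->
  pr (A `|` B) <= pr A + pr B.
Proof.
move=> mA mB; rewrite -lee_fin EFinD -!prE//; first exact: measureU2.
exact: measurableU.
Qed.

Let prD (A B : set T) : measurable A -> measurable B -> B `<=` A ->
  pr (A `\` B) = pr A - pr B.
Proof.
move=> mA mB BA; apply: EFin_inj; rewrite EFinB -!prE//;
  last exact: measurableD.
by rewrite measureD ?(setIidr BA)// ltey_eq fin_num_measure.
Qed.

Lemma atomless_half (A : set T) : measurable A -> 0 < pr A ->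
  exists B, [/\ measurable B, B `<=` A, 0 < pr B & pr B <= pr A / 2].
Proof.
move=> mA; rewrite -pr_gt0// => A0.
have [B [mB BA B0 BltA]] := aP mA A0.
rewrite pr_gt0// in B0; rewrite (prE mB) (prE mA) lte_fin in BltA.
have [B2|B2] := leP (pr B) (pr A / 2); first by exists B.
exists (A `\` B); split; first exact: measurableD.
- by move=> x [].
- by rewrite prD// subr_gt0.
- by rewrite prD//; lra.
Qed.

Lemma atomless_small (A : set T) (e : R) : measurable A -> 0 < pr A -> 0 < e ->
  exists B, [/\ measurable B, B `<=` A, 0 < pr B & pr B <= e].
Proof.
move=> mA A0 e0.
have H k : exists B, [/\ measurable B, B `<=` A,
  0 < pr B & pr B <= pr A / 2 ^+ k].
  elim: k => [|k [B [mB BA B0 Bk]]]; first by exists A; split => //;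
    rewrite expr0 divr1.
  have [C [mC CB C0 C2]] := atomless_half mB B0.
  exists C; split => //; first exact: subset_trans BA.
  by rewrite (le_trans C2)// exprSr invfM mulrA ler_pM2r.
pose k := Num.truncn (pr A / e).
have [B [mB BA B0 Bk]] := H k.+1; exists B; split => //.
rewrite (le_trans Bk)// ler_pdivrMr ?exprn_gt0// mulrC -ler_pdivrMr//.
rewrite (le_trans (ltW (truncnS_gt _)))// -natrX ler_nat ltnW//.
exact: ltn_expl.
Qed.

(* Sets of measure less than a third of that of A would be closed under finite
   unions; a maximal countable union of such sets can then be enlarged. *)
Lemma atomless_third (A : set T) : measurable A ->
  exists B, [/\ measurable B, B `<=` A,
    pr A / 3 <= pr B & pr B <= 2 * pr A / 3].
Proof.
move=> mA; have [A0|A0] := ltP 0 (pr A); last first.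
  have {}A0 : pr A = 0 by apply/eqP; rewrite eq_le A0 fine_ge0.
  by exists set0; split; rewrite ?A0 /pr ?measure0 ?mulr0 ?mul0r.
apply: contrapT => nomid.
have mid B : measurable B -> B `<=` A -> pr B <= 2 * pr A / 3 ->
  pr B < pr A / 3.
  by move=> mB BA B2; rewrite ltNge; apply/negP => B1; apply: nomid; exists B.
pose small B := [/\ measurable B, B `<=` A & pr B < pr A / 3].
(* Two sets below one third have a union of at most two thirds, and no set lies between the two
   thresholds. *)
have smallU B C : small B -> small C -> small (B `|` C).
  move=> [mB BA Bs] [mC CA Cs]; have mBC := measurableU _ _ mB mC.
  have BCA : B `|` C `<=` A by move=> x [/BA|/CA].
  by split => //; apply: mid => //; rewrite (le_trans (prU mB mC))//; lra.
have small0 : small set0.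
  by split=> //; rewrite /pr measure0/= divr_gt0.
pose S := [set pr B | B in small].
have supS : has_sup S.
  split; first by exists (pr set0), set0.
  by exists (pr A / 3) => _ [B [_ _ /ltW ?] <-].
have /choice[B BP] n : exists B, small B /\ sup S - n.+1%:R^-1 < pr B.
  have n0 : 0 < n.+1%:R^-1 :> R by rewrite invr_gt0.
  have [_ [B sB <-] ?] := sup_adherent n0 supS.
  by exists B.
pose C n := \big[setU/set0]_(i < n) B i.
have sC n : small (C n).
  by apply: big_ind => // i _; have [] := BP i.
pose D := \bigcup_n C n.
have mC n : measurable (C n) by have [] := sC n.
have mD : measurable D by exact: bigcupT_measurable.
have DA : D `<=` A by move=> x [n _ Cx]; have [_ + _] := sC n; apply.
have CD n : C n `<=` D by move=> x Cx; exists n.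
have Cnd : nondecreasing_seq C.
  apply/nondecreasing_seqP => n; apply/subsetPset; rewrite /C big_ord_recr/=.
  by move=> x; left.
have Dle : pr D <= pr A / 3.
  rewrite -lee_fin -prE//.
  have cv : P (C n) @[n --> \oo] --> P D by exact: nondecreasing_cvg_mu.
  rewrite -(cvg_lim _ cv)//; apply: lime_le.
    by apply/cvg_ex; eexists; exact: cv.
  by near=> n; rewrite prE// lee_fin ltW//; have [] := sC n.
have {Dle} sD : small D by split=> //; apply: mid => //;
  rewrite (le_trans Dle)//; lra.
have DS : sup S <= pr D.
  apply/ler_addgt0Pr => e e0.
  pose n := Num.truncn e^-1.
  have ne : n.+1%:R^-1 < e by rewrite invf_plt ?posrE// truncnS_gt.
  have [[mB BA _] Bn] := BP n.
  have : pr (B n) <= pr D.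
    apply: pr_le => // x Bx; apply: (CD n.+1); rewrite /C big_ord_recr/=.
    by right.
  move: Bn; rewrite ltrBlDr => Bn BD.
  by rewrite (le_trans (ltW Bn))// lerD// ltW.
have mAD : measurable (A `\` D) by exact: measurableD.
have AD0 : 0 < pr (A `\` D) by rewrite prD//; have [_ _] := sD; lra.
have A30 : 0 < pr A / 3 by rewrite divr_gt0.
(* [E] stays within a third so that [D] together with [E] is at most two thirds, hence small again;
   but its measure exceeds the supremum that [D] already attains. *)
have [E [mE EAD E0 E3]] := atomless_small mAD AD0 A30.
have mDE : measurable (D `|` E) by exact: measurableU.
have DEA : D `|` E `<=` A by move=> x [/DA//|/EAD[]].
have DED : (D `|` E) `\` D = E.
  apply/seteqP; split=> x; first by move=> [[]].
  by move=> Ex; split; [right|have [] := EAD _ Ex].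
have prDE : pr (D `|` E) = pr D + pr E.
  have := prD mDE mD (@subsetUl _ D E); rewrite DED => ->.
  by rewrite addrC subrK.
have [_ _ Dlt] := sD.
have sDE : small (D `|` E) by split => //; apply: mid => //; rewrite prDE; lra.
have : pr (D `|` E) <= sup S by apply: ub_le_sup; [case: supS|exists (D `|` E)].
rewrite prDE; lra.
Unshelve. all: by end_near. Qed.

End Atomless.

(** Splitting each [E n] with no quantitative control could degenerate in the limit to measure 0 or
    to full measure. Pieces between one and two thirds keep these proportions under the
    ultralimit. *)
Lemma loeb_atomless (R : realType) (U : set_system nat) (UF : UltraFilter U)
    (Uoo : \oo `<=` U) (d : nat -> measure_display)
    (T : forall n, measurableType (d n)) (P : forall n, probability (T n) R) :
  (forall n, atomless (P n)) -> atomless (loeb_prob UF Uoo P).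
Proof.
move=> aP A /measurable_loeb_rep[E AE].
have LPE := @loeb_probE _ _ UF Uoo _ _ P.
rewrite [X in (0 < X)%E](LPE _ _ AE) lte_fin => E0.
have [mE nE] := AE.
have [F FP] := dep_choice (fun n => atomless_third (aP n) (mE n)).
have mF : imeas F by move=> n; have [] := FP n.
have FE : internal U F `<=` internal U E.
  by apply: internal_monoP; apply: filterS filterT => n _; have [] := FP n.
have F1 : imu U P E / 3 <= imu U P F.
  have bE := ubounded_prob UF P mE; have bF := ubounded_prob UF P mF.
  have bc : ubounded U (fun=> 3^-1 : R) by exact: (@ubounded_bnd _ _ _ _
    `|3^-1|).
  rewrite -(ulim_cst UF (3^-1 : R)) -ulimM//; apply: ulim_le => //.
    exact: uboundedM.
  by apply: filterS filterT => n _; have [] := FP n.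
have F2 : imu U P F <= imu U P E * (2 / 3).
  have bE := ubounded_prob UF P mE; have bF := ubounded_prob UF P mF.
  have bc : ubounded U (fun=> 2 / 3 :
    R) by exact: (@ubounded_bnd _ _ _ _ `|2 / 3|).
  rewrite -(ulim_cst UF (2 / 3 : R)) -ulimM//; apply: ulim_le => //.
    exact: uboundedM.
  by apply: filterS filterT => n _; have [_ _ _] := FP n;
    rewrite mulrA [2 * _]mulrC.
have BF : loeb_rep U P (A `&` internal U F) F.
  split => //; apply: loeb_null_sub nE => w /= AF AEw; apply: AF;
    split => [[]//|Fw].
  by split => //; apply/AEw; exact: FE.
exists (A `&` internal U F); split.
- by exists F.
- by move=> w [].
- rewrite [X in (0 < X)%E](LPE _ _ BF) lte_fin; move: F1 E0; lra.
- rewrite [X in (X < _)%E](LPE _ _ BF).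
  rewrite [X in (_ < X)%E](LPE _ _ AE) lte_fin; move: F2 E0; lra.
Qed.

(** * Convergence of profiles *)

Section HausdorffLP.
Context (R : realType) (m : nat).
Implicit Types S : set (meas_Rm R m).

Lemma dLP_image_lb (f : meas_Rm R m -> R) S : (forall nu, 0 <= f nu) ->
  has_lbound [set f nu | nu in S].
Proof. by move=> f0; exists 0 => _ [nu _ <-]. Qed.

Lemma dH_le S1 S2 (e : R) : S1 !=set0 -> S2 !=set0 ->
  (forall mu, S1 mu -> exists2 nu, S2 nu & dLP mu nu <= e) ->
  (forall nu, S2 nu -> exists2 mu, S1 mu & dLP mu nu <= e) ->
  dH S1 S2 <= e.
Proof.
move=> [mu0 S1mu0] [nu0 S2nu0] H1 H2; rewrite /dH ge_max; apply/andP; split.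
  apply: ge_sup; first by eexists; exists mu0.
  move=> _ [mu /H1[nu S2nu mne] <-]; apply: le_trans mne.
  apply: ge_inf; last by exists nu.
  by apply: dLP_image_lb => ?; exact: dLP_ge0.
apply: ge_sup; first by eexists; exists nu0.
move=> _ [nu /H2[mu S1mu mne] <-]; apply: le_trans mne.
apply: (@ge_inf _ [set dLP mu nu | mu in S1]); last by exists mu.
by apply: (@dLP_image_lb (fun mu => dLP mu nu)) => ?; exact: dLP_ge0.
Qed.

Lemma dH_ge0 S1 S2 : 0 <= dH S1 S2.
Proof.
rewrite /dH le_max; apply/orP; left.
set E := [set _ | _ in _].
have E0 x : E x -> 0 <= x.
  move=> [mu _ <-].
  have [->|/set0P S0] := eqVneq [set dLP mu nu | nu in S2] set0;
    first by rewrite inf0.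
  by apply: lb_le_inf => // _ [nu _ <-]; exact: dLP_ge0.
have [supE|supE] := pselect (has_sup E); last by rewrite sup_out.
have [[x Ex] ubE] := supE.
by rewrite (le_trans (E0 _ Ex))// ub_le_sup.
Qed.

End HausdorffLP.

Section Profiles.
Context (R : realType) d (T : measurableType d) (P : probability T R).
Variables (A : Poperator P) (k : nat).

Definition admissible (v : 'I_k -> T -> R) :=
  forall i, measurable_fun setT (v i) /\ forall x, -1 <= v i x <= 1.

Lemma admissible0 : admissible (fun _ _ => 0).
Proof. by move=> i; split => // x; rewrite ler01 lerN10. Qed.

Lemma admissible_Linf v i : admissible v -> Linf_fun P (v i).
Proof.
by move=> /(_ i)[mv v1]; apply: (@Linf_bnd _ _ _ _ _ 1) => // x;
  rewrite ler_norml v1.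
Qed.

Lemma rvec_profile v : admissible v -> rvec (profile_vec A v).
Proof.
move=> av i; rewrite /profile_vec.
under eq_fun do rewrite mxE.
case: (fintype.split i) => j; first by have [] := av j.
by apply: Pop_meas; exact: admissible_Linf.
Qed.

Lemma profileP v : admissible v -> profile P A (jdistr P (profile_vec A v)).
Proof. by move=> av; exists v. Qed.

End Profiles.

(** The zero functions provide an element of each profile, and any two distributions are within 1.
    The terms of the series [dM] are thus dominated by a geometric series. *)
Lemma dH_profile_le1 (R : realType) d (T : measurableType d) (P :
  probability T R)
    d' (T' : measurableType d') (P' : probability T' R)
    (A : Poperator P) (B : Poperator P') k :
  dH (profile P A (k := k)) (profile P' B (k := k)) <= 1.
Proof.
have aA := @admissible0 R _ T k; have aB := @admissible0 R _ T' k.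
apply: dH_le.
- by eexists; exact: profileP aA.
- by eexists; exact: profileP aB.
- move=> _ [v av <-]; exists (jdistr P' (profile_vec B (fun _ : 'I_k =>
  fun=> 0))).
    exact: profileP.
  by apply: dLP_le1; exact: rvec_profile.
- move=> _ [v av <-]; exists (jdistr P (profile_vec A (fun _ : 'I_k =>
  fun=> 0))).
    exact: profileP.
  by apply: dLP_le1; exact: rvec_profile.
Qed.

(** * Joint distributions under lifting *)

Section ProfileLimit.
Context (R : realType) (U : set_system nat) (UF : UltraFilter U)
  (Uoo : \oo `<=` U)
  (d : nat -> measure_display) (T : forall n, measurableType (d n))
  (P : forall n, probability (T n) R) (A : forall n, Poperator (P n)).
Context (c p : R) (q : \bar R).
Hypotheses (c0 : 0 < c) (p1 : 1 <= p) (q1 : (1%:E < q)%E)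
  (Ac : forall n, (opnorm (P n) (A n) p%:E q <= c%:E)%E).

Local Notation L := (loeb UF Uoo P).
Local Notation LP := (loeb_prob UF Uoo P).
Local Notation ulf := (@ulf _ _ UF Uoo _ _ P).
Local Notation is_lift := (@is_lift _ _ UF Uoo _ _ P).
Local Notation LA := (loeb_Pop UF Uoo c0 p1 q1 Ac).

Variable k : nat.

(** The first [k] coordinates converge almost everywhere by definition of a lift; the last [k] do
    because the images are almost everywhere bounded along [U] and the limit operator may be
    computed with any lift. *)
Lemma dLP_profile_lift (v : 'I_k -> L -> R) (f : 'I_k -> forall n, T n -> R)
    (e : R) : 0 < e -> admissible v ->
      (forall n, admissible (fun j => f j n)) ->
  (forall j, is_lift 1 (v j) (f j)) ->
  \forall n \near U, dLP (jdistr (P n) (profile_vec (A n) (fun j => f j n)))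
                         (jdistr LP (profile_vec LA v)) <= e.
Proof.
move=> e0 av af vf.
apply: (@loeb_dLP _ _ UF Uoo _ _ P _ (fun n => profile_vec (A n) (fun j =>
  f j n))
  (profile_vec LA v)) => //.
- by move=> n; exact: rvec_profile.
- exact: rvec_profile.
apply: filter_forall => i.
have key : {ae LP, forall w, (fun n => match fintype.split i with
    inl j => f j n (w n) | inr j => A n (f j n) (w n) end) @ U -->
    match fintype.split i with inl j => v j w | inr j => LA (v j) w end}.
  case: (fintype.split i) => j; first exact: is_lift_cvg (vf j).
  have := loeb_opE c0 p1 q1 Ac (admissible_Linf LP j av) (vf j).
  apply: filterS2 (opf_ub c0 p1 q1 Ac (vf j)) => w ub /= ->.
  exact: cvg_ulim.
apply/loeb_aeP; move/loeb_aeP : key; apply: loeb_null_sub => w /= nw H;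
  apply: nw.
have XE : (fun n => profile_vec (A n) (fun j => f j n) (w n) ord0 i) =
    (fun n => match fintype.split i with
              inl j => f j n (w n) | inr j => A n (f j n) (w n) end).
  by apply/funext => n; rewrite mxE.
by rewrite XE /profile_vec mxE.
Qed.

Lemma dLP_profile_ulf (f : 'I_k -> forall n, T n -> R) :
  (forall n, admissible (fun j => f j n)) ->
  exists v : 'I_k -> L -> R, admissible v /\ forall e : R, 0 < e ->
  \forall n \near U, dLP (jdistr (P n) (profile_vec (A n) (fun j => f j n)))
                         (jdistr LP (profile_vec LA v)) <= e.
Proof.
move=> af; have f1 j n x : `|f j n x| <= 1.
  by rewrite ler_norml; have [_] := af n j.
have mf j n : measurable_fun setT (f j n) by have [] := af n j.
have av : admissible (fun j => ulf (f j)).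
  move=> j; split.
    by apply: measurable_ulf => //; apply: aeW; exact: ubf_bounded (f1 j).
  move=> w; have bw := ubf_bounded (f1 j) w.
  apply/andP; split; [apply: ulim_ge_cst|apply: ulim_le_cst] => //;
    by apply: filterS filterT => n _; have [_ /(_ (w n))/andP[]] := af n j.
exists (fun j => ulf (f j)); split => // e e0.
by apply: dLP_profile_lift => // j; exact: is_lift_ulf.
Qed.

Lemma profile_lift_exists (v : 'I_k -> L -> R) : admissible v ->
  exists f : 'I_k -> forall n, T n -> R, (forall n, admissible (fun j =>
    f j n)) /\
    forall j, is_lift 1 (v j) (f j).
Proof.
move=> av; have /choice[f fP] j : exists f, is_lift 1 (v j) f.
  have [mv v1] := av j; apply: loeb_lift => //.
  by apply: aeW => w; rewrite ler_norml.
exists f; split => // n j; have [mf f1 _] := fP j; split => // x.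
by rewrite -ler_norml.
Qed.

(** Otherwise [U]-many [n] have a function far from the limit profile; the ultralimit of these
    functions is admissible and close to [U]-many of them. Indices without a bad function receive
    zero functions. *)
Lemma profile_near_sub (e : R) : 0 < e -> \forall n \near U,
  forall v : 'I_k -> T n -> R, admissible v ->
  exists2 v' : 'I_k -> L -> R, admissible v' &
    dLP (jdistr (P n) (profile_vec (A n) v)) (jdistr LP (profile_vec LA v')) <=
      e.
Proof.
move=> e0; apply: contrapT => /(ultraC UF) nU.
pose bad n (v : 'I_k -> T n -> R) := forall v' : 'I_k -> L ->
  R, admissible v' ->
  e < dLP (jdistr (P n) (profile_vec (A n) v)) (jdistr LP (profile_vec LA v')).
pose isbad n := exists2 v : 'I_k -> T n -> R, admissible v & bad n v.
have [f fP] : exists f : forall n, 'I_k -> T n -> R, forall n,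
    admissible (f n) /\ (isbad n -> bad n (f n)).
  apply: (dep_choice (Q := fun n v => admissible v /\ (isbad n ->
    bad n v))) => n.
  have [[v av bv]|nbad] := pselect (isbad n); first by exists v.
  by exists (fun _ _ => 0); split => //; exact: admissible0.
have af n : admissible (fun j => f n j) by have [] := fP n.
have [v' [av' /(_ _ e0) vU]] := @dLP_profile_ulf (fun j n => f n j) af.
have [n [/= nn vn]] := @filter_ex _ U _ _ (filterI nU vU).
have bn : isbad n.
  apply: contrapT => nb; apply: nn => v av; apply: contrapT => nv.
  apply: nb; exists v => // v'' av''; rewrite ltNge; apply/negP => le;
    apply: nv.
  by exists v''.
by have [_ /(_ bn)/(_ _ av')] := fP n; rewrite ltNge vn.
Qed.

End ProfileLimit.

(** * Hausdorff convergence of profiles *)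

Section ProfileConvergence.
Context (R : realType) (U : set_system nat) (UF : UltraFilter U)
  (Uoo : \oo `<=` U)
  (d : nat -> measure_display) (T : forall n, measurableType (d n))
  (P : forall n, probability (T n) R) (A : forall n, Poperator (P n)).
Context (c p : R) (q : \bar R).
Hypotheses (c0 : 0 < c) (p1 : 1 <= p) (q1 : (1%:E < q)%E)
  (Ac : forall n, (opnorm (P n) (A n) p%:E q <= c%:E)%E).

Local Notation L := (loeb UF Uoo P).
Local Notation LP := (loeb_prob UF Uoo P).
Local Notation LA := (loeb_Pop UF Uoo c0 p1 q1 Ac).

(* Total boundedness of the profile of the limit operator is obtained by taking
   a second ultraproduct, of the constant sequence with value this operator. *)
Lemma profile_near_sup k (e : R) : 0 < e -> \forall n \near U,
  forall v : 'I_k -> L -> R, admissible v ->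
  exists2 v' : 'I_k -> T n -> R, admissible v' &
    dLP (jdistr (P n) (profile_vec (A n) v')) (jdistr LP (profile_vec LA v)) <=
      e.
Proof.
move=> e0.
have e8 : 0 < e / 8 by rewrite divr_gt0.
(* Three distances of [e / 8] will be chained; the larger constants supply the strict premises of
   the triangle inequality. *)
have [e44 lt34 lee] : [/\ e / 8 < e / 4, e / 4 + e / 4 < 3 * e / 4 &
  3 * e / 4 + e / 4 <= e] by split; lra.
apply: contrapT => /(ultraC UF) nU.
pose bad n (v : 'I_k -> L -> R) := forall v' : 'I_k -> T n ->
  R, admissible v' ->
  e < dLP (jdistr (P n) (profile_vec (A n) v')) (jdistr LP (profile_vec LA v)).
pose isbad n := exists2 v : 'I_k -> L -> R, admissible v & bad n v.
have /choice[f fP] n : exists v : 'I_k -> L -> R, admissible v /\ (isbad n ->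
  bad n v).
  have [[v av bv]|nbad] := pselect (isbad n); first by exists v.
  by exists (fun _ _ => 0); split => //; exact: admissible0.
have LAc (n : nat) : (opnorm LP LA p%:E q <= c%:E)%E by exact: loeb_op_opnorm.
have af n : admissible (fun j => f n j) by have [] := fP n.
(* The distribution of [v2] is close to that of [f n] for [U]-many [n]. Hence one fixed [f n0]
   approximates them all, and its lift [g] supplies the competitor that contradicts the badness of
   [f n]. *)
have [v2 [av2 /(_ _ e8) v2U]] := @dLP_profile_ulf _ _ UF Uoo _ (fun=> L) (fun=>
  LP)
  (fun=> LA) _ _ _ c0 p1 q1 LAc k (fun j n => f n j) af.
have [n0 fn0] := @filter_ex _ U _ _ v2U.
have [g [ag gP]] := @profile_lift_exists _ _ UF Uoo _ _ P k (f n0) (af n0).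
have gU := @dLP_profile_lift _ _ UF Uoo _ _ P A _ _ _ c0 p1 q1 Ac k (f n0) g _
  e8
  (af n0) ag gP.
have [n [[/= nn fn] gn]] := @filter_ex _ U _ _ (filterI (filterI nU v2U) gU).
have bn : isbad n.
  apply: contrapT => nb; apply: nn => v av; apply: contrapT => nv.
  apply: nb; exists v => // v'' av''; rewrite ltNge; apply/negP => le;
    apply: nv.
  by exists v''.
have [_ /(_ bn)/(_ _ (ag n))] := fP n; rewrite ltNge => /negP; apply.
have rg := rvec_profile (A n) (ag n).
have r0 := rvec_profile LA (af n0).
have rn := rvec_profile LA (af n).
have r2 := rvec_profile (loeb_Pop UF Uoo c0 p1 q1 LAc) av2.
have h1 := dLP_triangle_lt rg r0 r2 (le_lt_trans gn e44) (le_lt_trans fn0 e44).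
rewrite dLP_sym in fn.
have := dLP_triangle_lt rg r2 rn (le_lt_trans h1 lt34) (le_lt_trans fn e44).
by move/le_trans; apply.
Qed.

Lemma dH_profile_near k (e : R) : 0 < e -> \forall n \near U,
  dH (profile (P n) (A n) (k := k)) (profile LP LA (k := k)) <= e.
Proof.
move=> e0; have h1 := profile_near_sub UF Uoo c0 p1 q1 Ac k e0.
apply: filterS2 h1 (profile_near_sup k e0) => n h1 h2.
apply: dH_le.
- by eexists; exact: profileP (@admissible0 _ _ _ k).
- by eexists; exact: profileP (@admissible0 _ _ _ k).
- move=> _ [v av <-]; have [v' av' vv'] := h1 v av.
  by exists (jdistr LP (profile_vec LA v')) => //; exact: profileP.
- move=> _ [v av <-]; have [v' av' vv'] := h2 v av.
  by exists (jdistr (P n) (profile_vec (A n) v')) => //; exact: profileP.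
Qed.

End ProfileConvergence.

(** * The weighted series of the distance [dM] *)

Section WeightedSums.
Context (R : realType) (h : nat -> R).
Hypothesis h01 : forall k, 0 <= h k <= 1.

Let S (n : nat) : R := \sum_(1 <= k < n) 2 ^- k * h k.

Lemma wsum_nondecreasing : nondecreasing_seq S.
Proof.
apply/nondecreasing_seqP => -[|n]; first by rewrite /S !big_geq.
rewrite /S [leRHS]big_nat_recr//= lerDl mulr_ge0 ?invr_ge0 ?exprn_ge0//.
by have /andP[] := h01 n.+1.
Qed.

Lemma wsum_le K (e : R) n : 0 <= e -> (forall k, (k < K)%N -> h k <= e) ->
  S n <= 2 * e + 2 * 2 ^- K.
Proof.
move=> e0 hK.
have q0 j : 0 < 2 ^- j :> R by rewrite invr_gt0 exprn_gt0.
have qS j : 2 ^- j = 2 * 2 ^- j.+1 :> R by rewrite exprS invfM mulrA mulfV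
  ?mul1r.
have SS j : S j.+2 = S j.+1 + 2 ^- j.+1 * h j.+1 by rewrite /S big_nat_recr.
have S0 : S 0 = 0 by rewrite /S big_geq.
have S1 : S 1 = 0 by rewrite /S big_geq.
(* The subtracted term makes the bound inductive. The factor 2 on [e] lets it equal 0 at [j = 0],
   where the sum is empty. *)
have small j : (j <= K)%N -> S j <= 2 * e - 2 * e * 2 ^- j.
  elim: j => [|[|j] IH] jK; first by rewrite S0 expr0 invr1 mulr1 subrr.
    by rewrite S1 expr1; lra.
  have {}IH := IH (ltnW jK); rewrite SS.
  have := ler_wpM2l (ltW (q0 j.+1)) (hK _ jK).
  by move: IH; rewrite (qS j.+1); set x := 2 ^- j.+2; set y := h _;
    set z := S _; nra.
have big i : S (K + i) <= 2 * e + 2 * 2 ^- K - 2 * 2 ^- (K + i).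
  elim: i => [|i IH].
    by rewrite addn0 addrK (le_trans (small _ _))// gerBl !mulr_ge0// ltW.
  rewrite addnS; case KE : (K + i)%N IH => [|j] IH.
    by rewrite S1; move: IH; rewrite S0 expr1 expr0 invr1; have := q0 K; lra.
  rewrite SS.
  have /andP[_ h1] := h01 j.+1.
  have := ler_wpM2l (ltW (q0 j.+1)) h1.
  by move: IH; rewrite (qS j.+1); set x := 2 ^- j.+2; set y := h _;
    set z := S _; lra.
have [nK|nK] := leqP n K.
  apply: (le_trans (small _ nK)); have := q0 n; have := q0 K; nra.
have := big (n - K)%N; rewrite subnKC 1?ltnW// => /le_trans; apply.
by rewrite gerBl mulr_ge0// ltW.
Qed.

Lemma wsum_cvg : cvgn S.
Proof.
apply: nondecreasing_is_cvgn; first exact: wsum_nondecreasing.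
by exists (2 * 1 + 2 * 2 ^- 0) => _ [n _ <-]; apply: wsum_le.
Qed.

Lemma limn_wsum_ge0 : 0 <= limn S.
Proof.
apply: limr_ge; first exact: wsum_cvg.
near=> n; apply: sumr_ge0 => k _; rewrite mulr_ge0 ?invr_ge0 ?exprn_ge0//.
by have /andP[] := h01 k.
Unshelve. all: by end_near. Qed.

Lemma limn_wsum_le K (e : R) : 0 <= e -> (forall k, (k < K)%N -> h k <= e) ->
  limn S <= 2 * e + 2 * 2 ^- K.
Proof.
move=> e0 hK; apply: limr_le; first exact: wsum_cvg.
by near=> n; exact: wsum_le.
Unshelve. all: by end_near. Qed.

End WeightedSums.

(** * From the ultrafilter to a subsequence *)

Section Subsequence.
Context (R : realType) (U : set_system nat) (UF : UltraFilter U) (Uoo :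
  \oo `<=` U).

(** Every set of [U] meets every final segment of the integers, because [U] contains these segments;
    indices at which [u] is at most [1 / (k + 1)] can therefore be chosen increasingly. *)
Lemma ultra_subsequence (u : nat -> R) :
  (forall e, 0 < e -> \forall n \near U, `|u n| <= e) ->
  exists phi : nat -> nat, {homo phi : m n / (m < n)%N >-> (m < n)%N} /\
    (fun k => u (phi k)) @ \oo --> 0.
Proof.
move=> uU.
have /choice[g gP] (k : nat * nat) : exists n,
  (k.2 < n)%N /\ `|u n| <= k.1.+1%:R^-1.
  have /uU H1 : 0 < k.1.+1%:R^-1 :> R by rewrite invr_gt0.
  have H2 : \forall n \near U, (k.2 < n)%N by apply: Uoo; exists k.2.+1.
  by have [n []] := @filter_ex _ U _ _ (filterI H2 H1); exists n.
pose phi := fix phi k : nat := if k is j.+1 then g (j.+1, phi j) else g (0,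
  0)%N.
exists phi; split.
  apply: homo_ltn; first exact: ltn_trans.
  by move=> i; have [] := gP (i.+1, phi i).
have uphi k : `|u (phi k)| <= k.+1%:R^-1.
  by case: k => [|k]; [have [] := gP (0, 0)%N|have [] := gP (k.+1, phi k)].
apply/cvgrPdist_le => e e0; near=> k;
  rewrite sub0r normrN (le_trans (uphi k))//.
rewrite invf_ple ?posrE//; apply: (@le_trans _ _ k%:R); last by rewrite ler_nat.
by near: k; exact: nbhs_infty_ger.
Unshelve. all: by end_near. Qed.

End Subsequence.

(** The terms from [K] on contribute at most [2 * 2 ^- K], which is below [e / 2]. Only finitely
    many profiles remain, so one set of [U] makes all of them [e / 4]-close. *)
Lemma loeb_dM_near (R : realType) (U : set_system nat) (UF : UltraFilter U)
    (Uoo : \oo `<=` U) (d : nat -> measure_display)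
    (T : forall n, measurableType (d n)) (P : forall n, probability (T n) R)
    (A : forall n, Poperator (P n)) (c p : R) (q : \bar R)
    (c0 : 0 < c) (p1 : 1 <= p) (q1 : (1%:E < q)%E)
    (Ac : forall n, (opnorm (P n) (A n) p%:E q <= c%:E)%E) (e : R) : 0 < e ->
  \forall n \near U,
    `|dM (P n) (loeb_prob UF Uoo P) (A n) (loeb_Pop UF Uoo c0 p1 q1 Ac)| <= e.
Proof.
move=> e0.
pose h n k := dH (profile (P n) (A n) (k := k))
  (profile (loeb_prob UF Uoo P) (loeb_Pop UF Uoo c0 p1 q1 Ac) (k := k)).
have h01 n k : 0 <= h n k <= 1 by rewrite dH_ge0/=; exact: dH_profile_le1.
have [K Ke] : exists K, 2 * 2 ^- K <= e / 2.
  exists (Num.truncn (4 / e)).+1.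
  rewrite -ler_pdivlMl// invf_ple ?posrE ?exprn_gt0 ?mulr_gt0 ?divr_gt0
    ?invr_gt0//.
  rewrite -natrX (@le_trans _ _ (Num.truncn (4 / e)).+1%:R)//; last first.
    by rewrite ler_nat ltnW// ltn_expl.
  apply: le_trans (ltW (truncnS_gt _)).
  by rewrite !invfM !invrK; lra.
have e4 : 0 < e / 4 by rewrite divr_gt0.
have : \forall n \near U, forall k : 'I_K, h n k <= e / 4.
  by apply: filter_forall => k; exact: dH_profile_near.
apply: filterS => n hn.
rewrite ger0_norm; last exact: (limn_wsum_ge0 (h01 n)).
have hK k : (k < K)%N -> h n k <= e / 4 by move=> kK; exact: (hn (Ordinal kK)).
apply: le_trans (limn_wsum_le (h01 n) (ltW e4) hK) _.
by rewrite [leRHS]splitr lerD// mulrCA ler_pM2l// -[4]/(2 * 2)%:R natrM invfM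
  mulVKf.
Qed.

(* Compactness of the metric spaces (X_{p,q,c}, d_M) and (X'_{p,q,c}, d_M),
   stated as sequential compactness (equivalent for metric spaces): every
   sequence of P-operators with ||A_n||_{p->q} <= c has a subsequence
   d_M-converging to some P-operator A with ||A||_{p->q} <= c (defined on an
   atomless space in the primed case). *)
Theorem theorem2p12 (R : realType) (c p : R) (q : \bar R) :
  0 < c -> 1 <= p -> (1%:E < q)%E ->
  (forall (d : nat -> measure_display) (T : forall n, measurableType (d n))
          (P : forall n, probability (T n) R)
          (A : forall n, Poperator (P n)),
     (forall n, (opnorm (P n) (A n) p%:E q <= c%:E)%E) ->
     exists phi : nat -> nat, {homo phi : m n / (m < n)%N >-> (m < n)%N} /\
       exists (d' : measure_display) (T' : measurableType d')
              (P' : probability T' R) (A' : Poperator P'),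
         (opnorm P' A' p%:E q <= c%:E)%E /\
         (fun k => dM (P (phi k)) P' (A (phi k)) A') @ \oo --> 0)
  /\
  (forall (d : nat -> measure_display) (T : forall n, measurableType (d n))
          (P : forall n, probability (T n) R)
          (A : forall n, Poperator (P n)),
     (forall n, atomless (P n)) ->
     (forall n, (opnorm (P n) (A n) p%:E q <= c%:E)%E) ->
     exists phi : nat -> nat, {homo phi : m n / (m < n)%N >-> (m < n)%N} /\
       exists (d' : measure_display) (T' : measurableType d')
              (P' : probability T' R) (A' : Poperator P'),
         [/\ atomless P', (opnorm P' A' p%:E q <= c%:E)%E &
         (fun k => dM (P (phi k)) P' (A (phi k)) A') @ \oo --> 0]).
Proof.
move=> c0 p1 q1; have [U [UF Uoo]] := @ultraFilterLemma nat \oo _.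
split=> d T P A => [|aP] Ac.
  have [phi [phim phiM]] := ultra_subsequence UF Uoo (loeb_dM_near UF Uoo c0 p1
    q1 Ac).
  exists phi; split => //; do 4 eexists; split; last exact: phiM.
  exact: loeb_op_opnorm.
have [phi [phim phiM]] := ultra_subsequence UF Uoo (loeb_dM_near UF Uoo c0 p1
  q1 Ac).
exists phi; split => //; do 4 eexists; split; last exact: phiM.
  exact: loeb_atomless.
exact: loeb_op_opnorm.
Qed.
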